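(* Let $n>1$, $p$ an odd prime with $p\nmid n$, $q=p^a$, $t\in\mathbb{F}_q^*$. Then every $\eta\in\mathcal{C}_0$ can be written as $\eta=\sum_{i=0}^{2n}a_i(\eta)\widetilde{\varepsilon}_i+D_x\xi_x+D_y\xi_y$ with $a_i(\eta)\in\mathbb{Z}_q[\widetilde\gamma]$ and $\xi_x,\xi_y\in\mathcal{C}_0$; more precisely, $$\mathcal{C}_0=\bigoplus_{i=0}^{2n}\mathbb{Z}_q[\widetilde\gamma]\,\widetilde{\varepsilon}_i\ \oplus\ (D_x\mathcal{C}_0+D_y\mathcal{C}_0),$$ so $\{\widetilde\varepsilon_i\}_{0\le i\le 2n}$ is a basis of $\mathcal{C}_0/(D_x\mathcal{C}_0+D_y\mathcal{C}_0)$.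
   Context: $\mathbb{Q}_q$ is the unramified extension of $\mathbb{Q}_p$ of degree $a$ with ring of integers $\mathbb{Z}_q$; $\sigma$ is its Frobenius, extended to $\mathbb{Q}_q(\zeta_p,\widetilde\gamma)$ fixing $\zeta_p$ and $\widetilde\gamma$. Let $\gamma\in\mathbb{C}_p$ be a root of $\sum_{k\ge0}x^{p^k}/p^k$ with $\mathrm{ord}_p\gamma=\frac1{p-1}$, and fix $\widetilde\gamma$ with $\widetilde\gamma^n=\gamma$. Let $\bar t\in\mathbb{Z}_q$ be the Teichmüller lift of $t$. Weight: $\omega(a,b)=\frac an+b+\frac{2n+1}{n}\max\{0,-a,-b\}$ for $(a,b)\in\mathbb{Z}^2$. $\mathcal{C}_0$ is the space of formal series $\sum_{(a,b)\in\mathbb{Z}^2}\xi(a,b)\widetilde\gamma^{n\omega(a,b)}x^ay^b$ with $\xi(a,b)\in\mathbb{Z}_q[\widetilde\gamma]$ and $|\xi(a,b)|_p\to0$ as $\omega(a,b)\to\infty$. With $\gamma_i=\sum_{k=0}^{i}\gamma^{p^k}/p^k$, the operators on $\mathcal{C}_0$ are $D_x=x\frac{\partial}{\partial x}+\sum_{i\ge0}\gamma_ip^i\big(nx^{np^i}-\sigma^i(\bar t)x^{-p^i}y^{-p^i}\big)$ and $D_y=y\frac{\partial}{\partial y}+\sum_{i\ge0}\gamma_ip^i\big(y^{p^i}-\sigma^i(\bar t)x^{-p^i}y^{-p^i}\big)$ (multiplication operators composed appropriately). Set $\varepsilon_i=x^i$ for $0\le i\le n$ and $\varepsilon_i=x^{i-n}y$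 for $n+1\le i\le 2n$, and $\widetilde\varepsilon_i=\widetilde\gamma^{i}\varepsilon_i$ (note $n\omega(\varepsilon_i)=i$). *)

(* Defs.v *)
From HB Require Import structures.
From mathcomp Require Import all_boot all_order all_algebra.
From mathcomp Require Import all_classical all_reals all_analysis.

Set Implicit Arguments.
Unset Strict Implicit.
Unset Printing Implicit Defensive.

Import Order.TTheory GRing.Theory Num.Theory.
Import numFieldNormedType.Exports.

Local Open Scope classical_set_scope.
Local Open Scope ring_scope.

Section ValuedField.
Variables (R : realType) (C : closedFieldType) (abs : C -> R).

Definition cvg_abs (u : nat -> C) (l : C) : Prop :=
  (fun k => abs (u k - l)) @ \oo --> (0 : R).

Definition cauchy_abs (u : nat -> C) : Prop :=
  forall e : R, 0 < e ->
    exists N : nat, forall k m : nat, (N <= k)%N -> (N <= m)%N ->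
      abs (u k - u m) < e.

Definition psum (u : nat -> C) (N : nat) : C := \sum_(k < N) u k.

(* Takes the junk value 0 when the series diverges. *)
Definition infsum (u : nat -> C) : C := xget 0 [set l | cvg_abs (psum u) l].

(* The closure of the rationals: when [abs] is complete and extends the p-adic
   absolute value of the rationals, this is Q_p. *)
Definition Qp : set C :=
  [set x | exists u : nat -> rat, cvg_abs (fun k => ratr (u k)) x].

Definition algebraic_over (K : set C) (x : C) : Prop :=
  exists P : {poly C}, [/\ P != 0, forall i, K P`_i & root P x].

(* C_p as the completion of an algebraic closure of Q_p, normalized by
   |p| = 1/p. This determines [C] up to isometric isomorphism; [C] is
   algebraically closed by its type. *)
Record is_Cp (p : nat) : Prop := IsCp {
  Cp_abs_ge0 : forall x, 0 <= abs x;
  Cp_abs_eq0 : forall x, abs x = 0 <-> x = 0;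
  Cp_absM : forall x y, abs (x * y) = abs x * abs y;
  Cp_absD : forall x y, abs (x + y) <= Num.max (abs x) (abs y);
  Cp_absp : abs p%:R = p%:R^-1;
  Cp_complete : forall u, cauchy_abs u -> exists l, cvg_abs u l;
  Cp_dense : forall (x : C) (e : R), 0 < e ->
    exists y, algebraic_over Qp y /\ abs (x - y) < e }.

(* Only meaningful for x != 0: since [ln 0 = 0], [ordp p 0 = 0]. *)
Definition ordp (p : nat) (x : C) : R := - ln (abs x) / ln p%:R.

Definition is_subfield (K : set C) : Prop := divring_closed (mem K).

Definition gen_subfield (S : set C) : set C := smallest is_subfield S.

Definition is_field_aut (L : set C) (s : C -> C) : Prop :=
  [/\ s @` L = L, s 1 = 1,
      forall x y, L x -> L y -> s (x + y) = s x + s y &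
      forall x y, L x -> L y -> s (x * y) = s x * s y].

Definition integers (K : set C) : set C := [set x | K x /\ abs x <= 1].

Definition has_degree (K L : set C) (d : nat) : Prop :=
  exists b : 'I_d -> C, (forall i, L (b i)) /\
    forall x, L x ->
      exists! c : 'I_d -> C, (forall i, K (c i)) /\ x = \sum_i c i * b i.

(* Ramification index 1; residue field extensions are separable here, the
   residue field of Q_p being finite. *)
Definition unramified (K L : set C) : Prop :=
  forall x, L x -> x != 0 -> exists y, K y /\ abs x = abs y.

Definition is_Qq (a : nat) (L : set C) : Prop :=
  [/\ is_subfield L, Qp `<=` L, has_degree Qp L a & unramified Qp L].

(* [red] identifies F with the residue field of [L]; its values outside the
   integers of [L] are irrelevant. *)
Definition is_residue_map (L : set C) (F : finFieldType) (red : C -> F) : Prop :=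
  let O := integers L in
  [/\ red 1 = 1,
      forall x y, O x -> O y -> red (x + y) = red x + red y,
      forall x y, O x -> O y -> red (x * y) = red x * red y,
      forall x, O x -> (red x = 0 <-> abs x < 1) &
      forall t : F, exists2 x, O x & red x = t].

Definition is_teichmuller (L : set C) (F : finFieldType) (red : C -> F)
    (t : F) (tb : C) : Prop :=
  [/\ integers L tb, red tb = t & tb ^+ #|F| = tb].

Definition is_frobenius (p : nat) (L : set C) (s : C -> C) : Prop :=
  [/\ is_field_aut L s, forall x, Qp x -> s x = x &
      forall x, integers L x -> abs (s x - x ^+ p) < 1].

Definition adjoin (A : set C) (g : C) : set C :=
  [set x | exists2 P : {poly C}, (forall i, A P`_i) & x = P.[g]].

End ValuedField.

Section Modules.
Variables (K : nzRingType) (V : lmodType K) (S : set K).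

Definition is_submod (N : set V) : Prop :=
  N 0 /\ forall c f g, S c -> N f -> N g -> N (c *: f + g).

Definition line (e : V) : set V := [set c *: e | c in S].

Definition sumset (A B : set V) : set V :=
  [set v | exists f g, [/\ A f, B g & v = f + g]].

Definition is_direct_sum (I : finType) (M : set V) (N : I -> set V) : Prop :=
  [/\ is_submod M, forall i, is_submod (N i),
      M = [set \sum_i f i | f in [set f : I -> V | forall i, N i (f i)]] &
      forall f g : I -> V, (forall i, N i (f i)) -> (forall i, N i (g i)) ->
        \sum_i f i = \sum_i g i -> f = g].

(* The classes of the [e i] form an S-basis of the quotient M / W. *)
Definition is_quotient_basis (I : finType) (M W : set V) (e : I -> V) : Prop :=
  [/\ is_submod M, is_submod W, W `<=` M, forall i, M (e i) &
      forall m, M m -> exists! c : I -> K,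
        (forall i, S (c i)) /\ W (m - \sum_i c i *: e i)].

End Modules.

Definition wt (n : nat) (u : int * int) : rat :=
  u.1%:~R / n%:R + u.2%:~R
  + (2 * n + 1)%N%:R / n%:R * Num.max 0 (Num.max (- u.1%:~R) (- u.2%:~R)).

Definition nwt (n : nat) (u : int * int) : int :=
  u.1 + n%:Z * u.2 + (2 * n + 1)%N%:Z * Num.max 0 (Num.max (- u.1) (- u.2)).

Lemma nwtE (n : nat) (u : int * int) :
  (0 < n)%N -> (nwt n u)%:~R = n%:R * wt n u.
Proof.
move=> n0; have n0' : n%:R != 0 :> rat by rewrite pnatr_eq0 -lt0n.
have maxE (x y : int) : (Num.max x y)%:~R = Num.max x%:~R y%:~R :> rat.
  by rewrite !maxEle ler_int; case: ifP.
rewrite /nwt /wt !(rmorphD, rmorphM) /= !maxE !rmorphN rmorph0 !mulrDr.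
by rewrite mulrCA mulfV // mulr1 mulrA [X in _ = _ + X * _]mulrCA mulfV // mulr1.
Qed.

(* A formal series sum_u f(u) x^(u.1) y^(u.2), given by its coefficients. The
   codomain is the regular module C^o to get the pointwise C-module structure. *)
Notation laurent2 C := (int * int -> C^o).

Section Series.
Variables (R : realType) (C : closedFieldType) (abs : C -> R).

Definition monom (i j : int) : laurent2 C := fun u => (u == (i, j))%:R.

Definition mulmon (i j : int) (f : laurent2 C) : laurent2 C :=
  fun u => f (u.1 - i, u.2 - j).

Variables (p n : nat).

Definition C0 (A : set C) (gt : C) : set (laurent2 C) :=
  [set f | exists xi : int * int -> C,
    [/\ forall u, A (xi u),
        forall e : R, 0 < e ->
          exists M : rat, forall u, M <= wt n u -> abs (xi u) < e &
        forall u, f u = xi u * gt ^ nwt n u]].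

Definition gammai (gam : C) (i : nat) : C :=
  \sum_(k < i.+1) gam ^+ (p ^ k) / p%:R ^+ k.

Variables (gam tb : C) (sig : C -> C).

Definition Dx (f : laurent2 C) : laurent2 C := fun u =>
  u.1%:~R * f u +
  infsum abs (fun i => gammai gam i * p%:R ^+ i *
    (n%:R * mulmon (n * p ^ i)%N%:Z 0 f u
     - iter i sig tb * mulmon (- (p ^ i)%N%:Z) (- (p ^ i)%N%:Z) f u)).

Definition Dy (f : laurent2 C) : laurent2 C := fun u =>
  u.2%:~R * f u +
  infsum abs (fun i => gammai gam i * p%:R ^+ i *
    (mulmon 0 (p ^ i)%N%:Z f u
     - iter i sig tb * mulmon (- (p ^ i)%N%:Z) (- (p ^ i)%N%:Z) f u)).

Definition eps (i : nat) : laurent2 C :=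
  if (i <= n)%N then monom i%:Z 0 else monom (i - n)%N%:Z 1.

Definition teps (gt : C) (i : nat) : laurent2 C := gt ^+ i *: eps i.

End Series.

(* Main.v *)
(* Put A = Z_q[gt]. It is a complete discrete valuation ring with uniformizer
   [gt]: the defining equation of [gam] exhibits p / gt^(n (p-1)) as the solution
   of a contractive fixed point equation.

   Write X_u = gt^(nwt u) x^(u.1) y^(u.2), an orthonormal basis of C0 over A. The
   weight is additive exactly on the cones of the fan with rays (n,0), (0,1),
   (-1,-1), so modulo [gt] only the term i = 0 of the series in [Dx] and [Dy]
   survives, and it multiplies X_u by n x^n - t/(xy), resp. y - t/(xy), the
   product of monomials outside a common cone being 0. The lattice is partitioned
   into the translates eps_0 + N(0,1) + N(-1,-1), eps_i + N(n,0) + N(-1,-1) for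
   1 <= i <= n and eps_i + N(n,0) + N(0,1) for n < i <= 2n, and for a suitable
   order the leading exponent of Dx^a Dy^b eps_i runs bijectively through them.
   Hence the Dx^a Dy^b eps_i form an orthonormal basis of C0. Since Dx and Dy
   commute, Dx C0 + Dy C0 is spanned by the members with a + b > 0, and the eps_i
   are a basis of the quotient. *)

Require Import Defs.
From HB Require Import structures.
From mathcomp Require Import all_boot all_order all_algebra.
From mathcomp Require Import all_classical all_reals all_analysis.
From mathcomp Require Import ring zify.

Set Implicit Arguments.
Unset Strict Implicit.
Unset Printing Implicit Defensive.

Import Order.TTheory GRing.Theory Num.Theory.
Import numFieldNormedType.Exports.

Local Open Scope classical_set_scope.
Local Open Scope ring_scope.

(** * Ultrametric absolute values *)

(** Division by [gt] in Z_q[gt] needs the unit [p / gt^(n (p-1))], which is a priori only a limit,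
    and completeness is read off from expansions that already use this division. To break the
    circle, divisibility is first proved in the topological closure of the ring, and the closure is
    then shown to be the ring itself.

    No infinite expansion in the Dx^a Dy^b eps_i is ever formed: finite combinations approximate C0
    modulo every gt^m, and a finite combination lying in gt^m C0 has all its coefficients divisible
    by gt^m. These two facts suffice.

    The order on exponents is lexicographic in weight, cone and a slope. The cone decides on a wall
    between two cones; the slope decides in the one cone that contains both monomials of an
    operator.

    Dx and Dy commute because they are E + E(H) for E = x d/dx and E = y d/dy with the same H, the
    sum of the gamma_i (x^(n p^i) + y^(p^i) + sigma^i(tb) x^(-p^i) y^(-p^i)). *)

Section Ultrametric.
Variables (R : realType) (C : closedFieldType) (abs : C -> R) (p : nat).
Hypothesis CC : is_Cp abs p.

Lemma abs0 : abs 0 = 0. Proof. exact/(Cp_abs_eq0 CC). Qed.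

Lemma abs_ge0 x : 0 <= abs x. Proof. exact: (Cp_abs_ge0 CC). Qed.

Lemma absM x y : abs (x * y) = abs x * abs y.
Proof. exact: (Cp_absM CC). Qed.

Lemma abs_gt0 x : x != 0 -> 0 < abs x.
Proof.
by move=> /eqP x0; rewrite lt0r abs_ge0 andbT; apply/eqP => /(Cp_abs_eq0 CC).
Qed.

Lemma abs1 : abs 1 = 1.
Proof.
have a0 : abs 1 != 0 by rewrite gt_eqF // abs_gt0 // oner_neq0.
by apply: (mulfI a0); rewrite -absM !mulr1.
Qed.

Lemma absN x : abs (- x) = abs x.
Proof.
suff aN1 : abs (-1) = 1 by rewrite -mulN1r absM aN1 mul1r.
apply/eqP; rewrite -(@eqrXn2 _ 2) ?abs_ge0 ?ler01 //.
by rewrite expr1n expr2 -absM mulrNN mulr1 abs1.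
Qed.

Lemma absX x k : abs (x ^+ k) = abs x ^+ k.
Proof. by elim: k => [|k IH]; rewrite ?expr0 ?abs1 // !exprS absM IH. Qed.

Lemma absV x : abs x^-1 = (abs x)^-1.
Proof.
have [->|x0] := eqVneq x 0; first by rewrite invr0 abs0 invr0.
have a0 : abs x != 0 by rewrite gt_eqF // abs_gt0.
by apply: (mulfI a0); rewrite -absM !divff // abs1.
Qed.

Lemma abs_leD Y x y : abs x <= Y -> abs y <= Y -> abs (x + y) <= Y.
Proof. by move=> hx hy; rewrite (le_trans (Cp_absD CC x y)) // ge_max hx. Qed.

Lemma abs_leB Y x y : abs x <= Y -> abs y <= Y -> abs (x - y) <= Y.
Proof. by move=> hx hy; rewrite abs_leD // absN. Qed.

Lemma abs_ltD Y x y : abs x < Y -> abs y < Y -> abs (x + y) < Y.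
Proof. by move=> hx hy; rewrite (le_lt_trans (Cp_absD CC x y)) // gt_max hx. Qed.

Lemma abs_ltB Y x y : abs x < Y -> abs y < Y -> abs (x - y) < Y.
Proof. by move=> hx hy; rewrite abs_ltD // absN. Qed.

Lemma abs_distC x y : abs (x - y) = abs (y - x).
Proof. by rewrite -absN opprB. Qed.

Lemma abs_le_sum (I : Type) (s : seq I) (P : pred I) (F : I -> C) Y :
  0 <= Y -> (forall i, P i -> abs (F i) <= Y) ->
  abs (\sum_(i <- s | P i) F i) <= Y.
Proof.
move=> Y0 hF; elim/big_ind: _ => //; first by rewrite abs0.
by move=> x y; apply: abs_leD.
Qed.

Lemma abs_lt_sum (I : eqType) (s : seq I) (P : pred I) (F : I -> C) Y :
  0 < Y -> (forall i, i \in s -> P i -> abs (F i) < Y) ->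
  abs (\sum_(i <- s | P i) F i) < Y.
Proof.
move=> Y0 hF; rewrite big_seq_cond; elim/big_ind: _.
- by rewrite abs0.
- by move=> x y; apply: abs_ltD.
- by move=> i /andP[]; apply: hF.
Qed.

Lemma abs_nat_le1 k : abs k%:R <= 1.
Proof.
elim: k => [|k IH]; first by rewrite abs0 ler01.
by rewrite -natr1 abs_leD // abs1.
Qed.

Lemma abs_int_le1 k : abs k%:~R <= 1.
Proof. by case: k => k; rewrite ?NegzE ?rmorphN /= ?absN abs_nat_le1. Qed.

(** Otherwise [x], being the difference of [x + y] and [y], would be smaller than itself. *)
Lemma abs_domD x y : abs y < abs x -> abs (x + y) = abs x.
Proof.
move=> yx; apply/eqP; rewrite eq_le abs_leD ?(ltW yx) //=.
rewrite leNgt; apply/negP => h.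
by have := abs_ltB h yx; rewrite addrK ltxx.
Qed.

Lemma cvg_absP (u : nat -> C) l : cvg_abs abs u l <->
  forall e, 0 < e -> exists N, forall k, (N <= k)%N -> abs (u k - l) < e.
Proof.
split=> [/cvgrPdist_lt h e e0|h].
  have [N _ hN] := h _ e0; exists N => k Nk.
  by have := hN k Nk; rewrite /= sub0r normrN ger0_norm // abs_ge0.
apply/cvgrPdist_lt => e e0; have [N hN] := h _ e0; exists N => // k /= Nk.
by rewrite sub0r normrN ger0_norm ?abs_ge0 // hN.
Qed.

Lemma abs_eq0P x : (forall e, 0 < e -> abs x < e) -> x = 0.
Proof.
move=> h; apply/eqP/negPn/negP => /abs_gt0 x0.
by have := h _ x0; rewrite ltxx.
Qed.

Lemma cvg_abs_uniq (u : nat -> C) l l' :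
  cvg_abs abs u l -> cvg_abs abs u l' -> l = l'.
Proof.
move=> /cvg_absP h /cvg_absP h'; apply/eqP; rewrite -subr_eq0; apply/eqP.
apply: abs_eq0P => e e0; have [N hN] := h _ e0; have [N' hN'] := h' _ e0.
have -> : l - l' = (u (maxn N N') - l') - (u (maxn N N') - l) by ring.
by rewrite abs_ltB ?hN ?hN' ?leq_maxl ?leq_maxr.
Qed.

Lemma infsumE (u : nat -> C) l : cvg_abs abs (psum u) l -> infsum abs u = l.
Proof.
by move=> h; apply: xget_unique => // l' h'; apply: (cvg_abs_uniq h' h).
Qed.

Lemma geom_small (r b e : R) : 0 <= r < 1 -> 0 < e ->
  exists N, forall k, (N <= k)%N -> b * r ^+ k < e.
Proof.
move=> /andP[r0 r1] e0.
have h : (fun k => b * r ^+ k) @ \oo --> b * 0.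
  by apply: cvgMr; apply: cvg_expr; rewrite ger0_norm.
move: h; rewrite mulr0 => /cvgrPdist_lt /(_ _ e0) [N _ hN]; exists N => k Nk.
have := hN k Nk; rewrite /= sub0r normrN => h.
by apply: le_lt_trans h; apply: ler_norm.
Qed.

Lemma geom_cvg (r b : R) (u : nat -> C) l : 0 <= r < 1 ->
  (forall N, abs (u N - l) <= b * r ^+ N) -> cvg_abs abs u l.
Proof.
move=> r01 h; apply/cvg_absP => e e0; have [N hN] := geom_small b r01 e0.
by exists N => k /hN; apply: le_lt_trans.
Qed.

Lemma abs_eq0_geom (r b : R) x : 0 <= r < 1 ->
  (forall N, abs x <= b * r ^+ N) -> x = 0.
Proof.
move=> r01 h; apply: abs_eq0P => e e0; have [N hN] := geom_small b r01 e0.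
by apply: le_lt_trans (h N) (hN _ _).
Qed.

Lemma psumS (u : nat -> C) N : psum u N.+1 = psum u N + u N.
Proof. by rewrite /psum big_ord_recr. Qed.

Lemma series_geom (r b : R) (u : nat -> C) : 0 <= r < 1 -> 0 <= b ->
  (forall i, abs (u i) <= b * r ^+ i) ->
  exists l, forall N, abs (psum u N - l) <= b * r ^+ N.
Proof.
move=> r01 b0 hu; have /andP[r0 r1] := r01.
have tail N k : abs (psum u (N + k) - psum u N) <= b * r ^+ N.
  elim: k => [|k IH].
    by rewrite addn0 subrr abs0 mulr_ge0 // exprn_ge0.
  rewrite addnS psumS addrAC abs_leD // (le_trans (hu _)) //.
  by rewrite ler_wpM2l // exprD ler_piMr ?exprn_ge0 // exprn_ile1 // ltW.
have [l /cvg_absP hl] : exists l, cvg_abs abs (psum u) l.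
  apply: (Cp_complete CC) => e e0; have [N hN] := geom_small b r01 e0.
  exists N => k m Nk Nm.
  have -> : psum u k - psum u m = (psum u k - psum u N) - (psum u m - psum u N)
    by ring.
  by apply: abs_ltB; (apply: le_lt_trans (hN N _) => //);
    [rewrite -(subnKC Nk) | rewrite -(subnKC Nm)].
(* The bound survives the limit with the same constant: if the distance to [l] exceeded it, a late
   partial sum would be closer to [l] than that distance, which would then be strictly smaller than
   itself. *)
exists l => N; rewrite leNgt; apply/negP => h.
have B0 : 0 < abs (psum u N - l) by apply: le_lt_trans h; rewrite mulr_ge0 ?exprn_ge0.
have [M hM] := hl _ B0.
have : abs (psum u N - l) < abs (psum u N - l).
  have {1}-> : psum u N - l = (psum u (N + M) - l) - (psum u (N + M) - psum u N)
    by ring.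
  by apply: abs_ltB; [exact: (hM _ (leq_addl _ _)) | exact: (le_lt_trans (tail N M) h)].
by rewrite ltxx.
Qed.

End Ultrametric.

(** * The weight on the lattice of exponents *)

Section Lattice.
Variable n : nat.
Hypothesis n_gt0 : (0 < n)%N.
Implicit Types u v : int * int.

Definition nw u : nat := `|nwt n u|%N.

(** [vP k], [vQ k] and [vS k] are the exponents of x^(nk), y^k and (xy)^(-k), the monomials of the
    operators; all three have [nwt] equal to nk. *)
Definition vP (k : nat) : int * int := ((n * k)%N%:Z, 0).
Definition vQ (k : nat) : int * int := (0, k%:Z).
Definition vS (k : nat) : int * int := (- k%:Z, - k%:Z).

Definition depth u : int := Num.max 0 (Num.max (- u.1) (- u.2)).

Lemma nwt_depth u : nwt n u = u.1 + n%:Z * u.2 + (2 * n + 1)%N%:Z * depth u.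
Proof. by []. Qed.

Lemma depthP u :
  [/\ 0 <= depth u, - u.1 <= depth u, - u.2 <= depth u &
      depth u = 0 \/ depth u = - u.1 \/ depth u = - u.2].
Proof. by rewrite /depth; split; lia. Qed.

Lemma nwt_ge0 u : 0 <= nwt n u.
Proof. by rewrite nwt_depth; have [] := depthP u; nia. Qed.

Lemma nwE u : (nw u)%:Z = nwt n u.
Proof. by rewrite /nw gez0_abs // nwt_ge0. Qed.

(** The weight is subadditive, [depth] being a maximum of linear forms; this and the next two lemmas
    are the cases of the three shifts. *)
Lemma nwt_leP u k : nwt n u <= nwt n (u - vP k) + (n * k)%N%:Z.
Proof.
rewrite !nwt_depth /=; have [] := depthP u; have [] := depthP (u - vP k) => /=.
nia.
Qed.

Lemma nwt_leQ u k : nwt n u <= nwt n (u - vQ k) + (n * k)%N%:Z.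
Proof.
rewrite !nwt_depth /=; have [] := depthP u; have [] := depthP (u - vQ k) => /=.
nia.
Qed.

Lemma nwt_leS u k : nwt n u <= nwt n (u - vS k) + (n * k)%N%:Z.
Proof.
rewrite !nwt_depth /=; have [] := depthP u; have [] := depthP (u - vS k) => /=.
nia.
Qed.

(** The rest of [nwt] is linear, so additivity of the weight is additivity of [depth]; it singles
    out the exponents sharing a closed cone with the shift. *)
Lemma depth_addP u : nwt n (u + vP 1) = nwt n u + n%:Z ->
  depth (u + vP 1) = depth u.
Proof. by rewrite !nwt_depth /=; nia. Qed.

Lemma depth_addQ u : nwt n (u + vQ 1) = nwt n u + n%:Z ->
  depth (u + vQ 1) = depth u.
Proof. by rewrite !nwt_depth /=; nia. Qed.

Lemma depth_addS u : nwt n (u + vS 1) = nwt n u + n%:Z ->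
  depth (u + vS 1) = depth u + 1.
Proof. by rewrite !nwt_depth /=; nia. Qed.

(** * The order on exponents *)

(** Half-open cones, partitioning the lattice. The numbering matters: from a wall, a monomial that
    leaves the half-open cone while keeping the weight additive lands in a cone of smaller number,
    and so loses to the one that stays. *)
Definition cone u : int :=
  if (u.1 <= 0) && (u.1 <= u.2) then 2 else if u.2 <= 0 then 1 else 0.

Lemma cone_bound u : 0 <= cone u <= 2.
Proof. by rewrite /cone; case: ifP => //; case: ifP. Qed.

(** The coordinate along (0,1) in cone 2 and along (1,0) in cone 1, the other direction being
    (-1,-1). *)
Definition slope u : int :=
  if (u.1 <= 0) && (u.1 <= u.2) then u.2 - u.1
  else if u.2 <= 0 then u.1 - u.2 else 0.

(** Since [cone] is at most 2, comparing levels compares the weight first and the cone second. *)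
Definition level u : int := 3 * nwt n u + cone u.

Definition below u v :=
  (level u < level v) || (level u == level v) && (slope u < slope v).

(** Maps the order to the naturals for inductions: the slope is at most the level, hence smaller
    than the gap to the next square. *)
Definition rank u : nat := `|(level u ^+ 2 + slope u)%R|%N.

(** The winning exponent under [Dx]: cone 2 contains (-1,-1) but not (n,0). Elsewhere (n,0) stays in
    the cone, and in cone 1, where (-1,-1) stays as well, it gives the larger slope. For [sy], cones
    1 and 2 exchange roles. *)
Definition sx u := if cone u == 2 then u + vS 1 else u + vP 1.
Definition sy u := if cone u == 1 then u + vS 1 else u + vQ 1.

Lemma below_irr u : below u u = false.
Proof. by rewrite /below !ltxx eqxx. Qed.

Lemma below_trans u v w : below u v -> below v w -> below u w.
Proof.
rewrite /below.
by move: (level u) (level v) (level w) (slope u) (slope v) (slope w) => *; lia.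
Qed.

Lemma below_nwt u v : nwt n u < nwt n v -> below u v.
Proof.
rewrite /below /level; have := cone_bound u; have := cone_bound v.
by move: (nwt n u) (nwt n v) (cone u) (cone v) => *; lia.
Qed.

Lemma regionP u :
  [\/ [/\ u.1 <= 0, u.1 <= u.2, cone u = 2, slope u = u.2 - u.1 & depth u = - u.1],
      [/\ u.2 <= 0, u.2 < u.1, cone u = 1, slope u = u.1 - u.2 & depth u = - u.2] |
      [/\ 0 < u.1, 0 < u.2, cone u = 0, slope u = 0 & depth u = 0]].
Proof.
case: u => x y; rewrite /cone /slope /depth /=.
case: ifP => h; [apply: Or31 | case: ifP => h'; [apply: Or32 | apply: Or33]];
  by split=> //; lia.
Qed.

Lemma slope_bound u : 0 <= slope u <= nwt n u.
Proof.
by rewrite nwt_depth; case: (regionP u) => -[h1 h2 _ -> ->]; nia.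
Qed.

Lemma below_rank u v : below u v -> (rank u < rank v)%N.
Proof.
rewrite /below /rank /level; have := slope_bound u; have := slope_bound v.
have := cone_bound u; have := cone_bound v.
move: (nwt n u) (nwt n v) (cone u) (cone v) (slope u) (slope v).
move=> a b c d e f *; rewrite !expr2; nia.
Qed.

Lemma sx_facts u : [/\ nwt n (sx u) = nwt n u + n%:Z, cone (sx u) = cone u &
  slope (sx u) = slope u + (if cone u == 1 then n%:Z else 0)].
Proof.
rewrite !nwt_depth /sx; case: (regionP u) => -[h1 h2 -> -> ->] /=.
- case: (regionP (u + vS 1)) => /= -[? ? -> -> ->]; split=> //; nia.
- case: (regionP (u + vP 1)) => /= -[? ? -> -> ->]; split=> //; nia.
- case: (regionP (u + vP 1)) => /= -[? ? -> -> ->]; split=> //; nia.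
Qed.

Lemma sy_facts u : [/\ nwt n (sy u) = nwt n u + n%:Z, cone (sy u) = cone u &
  slope (sy u) = slope u + (if cone u == 2 then 1 else 0)].
Proof.
rewrite !nwt_depth /sy; case: (regionP u) => -[h1 h2 -> -> ->] /=.
- case: (regionP (u + vQ 1)) => /= -[? ? -> -> ->]; split=> //; nia.
- case: (regionP (u + vS 1)) => /= -[? ? -> -> ->]; split=> //; nia.
- case: (regionP (u + vQ 1)) => /= -[? ? -> -> ->]; split=> //; nia.
Qed.

(** The increment of the slope depends on the cone alone, and slopes are compared only inside one
    cone. *)
Lemma below_sx u v : below u v -> below (sx u) (sx v).
Proof.
have [wu cu su] := sx_facts u; have [wv cv sv] := sx_facts v.
rewrite /below /level wu cu su wv cv sv.
have := cone_bound u; have := cone_bound v.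
move: (nwt n u) (nwt n v) (cone u) (cone v) (slope u) (slope v).
by move=> a b c d e f *; case: ifP; case: ifP; lia.
Qed.

Lemma below_sy u v : below u v -> below (sy u) (sy v).
Proof.
have [wu cu su] := sy_facts u; have [wv cv sv] := sy_facts v.
rewrite /below /level wu cu su wv cv sv.
have := cone_bound u; have := cone_bound v.
move: (nwt n u) (nwt n v) (cone u) (cone v) (slope u) (slope v).
by move=> a b c d e f *; case: ifP; case: ifP; lia.
Qed.

Lemma sx_lead u v : v = u + vP 1 \/ v = u + vS 1 ->
  nwt n v = nwt n u + n%:Z -> v = sx u \/ below v (sx u).
Proof.
move=> uv nv; have [nx cx sx_] := sx_facts u.
rewrite /below /level nx cx sx_ nv.
case: uv nv => -> nv.
- have := depth_addP nv; rewrite /sx; case: (regionP (u + vP 1)) => /= -[? ? -> -> ->];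
    case: (regionP u) => -[h1 h2 -> -> ->] /= ?; first [by left | right; lia | lia].
- have := depth_addS nv; rewrite /sx; case: (regionP (u + vS 1)) => /= -[? ? -> -> ->];
    case: (regionP u) => -[h1 h2 -> -> ->] /= ?; first [by left | right; lia | lia].
Qed.

Lemma sy_lead u v : v = u + vQ 1 \/ v = u + vS 1 ->
  nwt n v = nwt n u + n%:Z -> v = sy u \/ below v (sy u).
Proof.
move=> uv nv; have [ny cy sy_] := sy_facts u.
rewrite /below /level ny cy sy_ nv.
case: uv nv => -> nv.
- have := depth_addQ nv; rewrite /sy; case: (regionP (u + vQ 1)) => /= -[? ? -> -> ->];
    case: (regionP u) => -[h1 h2 -> -> ->] /= ?; first [by left | right; lia | lia].
- have := depth_addS nv; rewrite /sy; case: (regionP (u + vS 1)) => /= -[? ? -> -> ->];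
    case: (regionP u) => -[h1 h2 -> -> ->] /= ?; first [by left | right; lia | lia].
Qed.

(* [(i, a, b)] stands for the exponent of the leading monomial of
   [Dx^a Dy^b eps_i]. *)
Definition pt (j : nat * nat * nat) : int * int :=
  let: (i, a, b) := j in
  if i == 0%N then (- a%:Z, b%:Z - a%:Z)
  else if (i <= n)%N then ((i + n * a)%N%:Z - b%:Z, - b%:Z)
  else ((i - n + n * a)%N%:Z, 1 + b%:Z).

Lemma nwt_pt i a b : nwt n (pt (i, a, b)) = (i + n * (a + b))%N%:Z.
Proof.
rewrite nwt_depth /=; case: ifP => [/eqP ->|i0]; last case: ifP => ni.
- rewrite (_ : depth _ = a%:Z); last by rewrite /depth /=; lia.
  by rewrite /= !PoszD !PoszM; ring.
- rewrite (_ : depth _ = b%:Z); last first.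
    by rewrite /depth /=; move: (n * a)%N => c; lia.
  by rewrite /= !PoszD !PoszM; ring.
- rewrite (_ : depth _ = 0); last by rewrite /depth /=; lia.
  by rewrite /= !PoszD !PoszM -subzn; [ring | lia].
Qed.

Lemma nw_pt i a b : nw (pt (i, a, b)) = (i + n * (a + b))%N.
Proof. by rewrite /nw nwt_pt. Qed.

Lemma cone_pt i a b :
  cone (pt (i, a, b)) = if i == 0%N then 2 else if (i <= n)%N then 1 else 0.
Proof.
rewrite /=; case: ifP => [_|i0]; last case: ifP => ni.
- by rewrite /cone /= ifT //; lia.
- by rewrite /cone /= ifF ?ifT //; nia.
- by rewrite /cone /= ifF ?ifF //; lia.
Qed.

Lemma pt_sx i a b : pt (i, a.+1, b) = sx (pt (i, a, b)).
Proof.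
rewrite /sx cone_pt /=; case: ifP => [_|i0]; last case: ifP => ni /=.
- by congr pair => /=; lia.
- by congr pair => /=; lia.
- by congr pair => /=; lia.
Qed.

Lemma pt_sy i a b : pt (i, a, b.+1) = sy (pt (i, a, b)).
Proof.
rewrite /sy cone_pt /=; case: ifP => [_|i0]; last case: ifP => ni /=.
- by congr pair => /=; lia.
- by congr pair => /=; lia.
- by congr pair => /=; lia.
Qed.

(** The cone tells which of the three families is meant; where i > 0, division by [n] with remainder
    in 1..n recovers [i] and [a]. *)
Lemma pt_inj i a b i' a' b' : (i <= 2 * n)%N -> (i' <= 2 * n)%N ->
  pt (i, a, b) = pt (i', a', b') -> (i, a, b) = (i', a', b').
Proof.
move=> hi hi' e.
have divE k l c d : (0 < k <= n)%N -> (0 < l <= n)%N ->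
    (k + n * c = l + n * d)%N -> k = l /\ c = d.
  move=> hk hl h; have cd : c = d; last by split=> //; rewrite cd in h; lia.
  by case: (ltngtP c d) => // lt; have := leq_mul (leqnn n) lt; lia.
have := congr1 cone e; rewrite !cone_pt; move: e => /=.
case: eqP => [->|i0]; case: eqP => [->|i0'] //=.
- by case=> ? ? _; congr (_, _, _); lia.
- by case: ifP.
- by case: ifP.
case: ifP => ni; case: ifP => ni' // [e1 e2] _.
- have [|||-> ->] := divE i i' a a'; try lia; by congr (_, _); lia.
- have [|||h ->] := divE (i - n)%N (i' - n)%N a a'; try lia.
  by congr (_, _, _); lia.
Qed.

Lemma pt_surj u : exists i a b, (i <= 2 * n)%N /\ u = pt (i, a, b).
Proof.
case: (regionP u) => -[h1 h2 _ _ _].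
- exists 0%N, `|u.1|%N, `|(u.2 - u.1)%R|%N; split=> //.
  by rewrite /= [LHS]surjective_pairing; congr pair; lia.
(* Subtracting 1 before the division and adding it back makes the remainder run through 1..n instead
   of 0..n-1. *)
- set d := `|(u.1 - u.2 - 1)%R|%N; exists (d %% n).+1, (d %/ n)%N, `|u.2|%N.
  have := ltn_pmod d n_gt0; have := divn_eq d n => e lt; split; first by lia.
  by rewrite /= ifT // [LHS]surjective_pairing; congr pair; lia.
- set d := `|(u.1 - 1)%R|%N; exists (n + (d %% n).+1)%N, (d %/ n)%N, `|(u.2 - 1)%R|%N.
  have := ltn_pmod d n_gt0; have := divn_eq d n => e lt; split; first by lia.
  rewrite /= ifF ?ifF; [|lia|lia].
  by rewrite [LHS]surjective_pairing; congr pair; lia.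
Qed.

End Lattice.

(** * The ring Z_q[gt] *)

(* A complete discrete valuation ring with uniformizer [gt]. *)
Record is_unif_ring (R : realType) (C : closedFieldType) (abs : C -> R)
    (A : set C) (gt : C) : Prop := IsUnifRing {
  ur_1 : A 1;
  ur_B : forall x y, A x -> A y -> A (x - y);
  ur_M : forall x y, A x -> A y -> A (x * y);
  ur_gt : A gt;
  ur_itv : 0 < abs gt < 1;
  ur_le1 : forall x, A x -> abs x <= 1;
  ur_closed : forall x,
    (forall m, exists2 y, A y & abs (x - y) <= abs gt ^+ m) -> A x;
  ur_div : forall m x, A x -> abs x <= abs gt ^+ m -> A (x / gt ^+ m);
  ur_lt1 : forall x, A x -> abs x < 1 -> abs x <= abs gt;
  ur_V : forall x, A x -> abs x = 1 -> A x^-1 }.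

Section AdjoinedIntegers.
Variables (R : realType) (C : closedFieldType) (abs : C -> R) (p : nat).
Hypotheses (p_prime : prime p) (CC : is_Cp abs p).

(** * Absolute values of rationals and of elements of Q_p *)

Lemma p_neq0 : p%:R != 0 :> C.
Proof.
apply/eqP => p0; have := Cp_absp CC; rewrite p0 (abs0 CC) => /eqP.
by rewrite eq_sym invr_eq0 pnatr_eq0 -leqn0 leqNgt prime_gt0.
Qed.

Lemma invp_itv : 0 <= (p%:R^-1 : R) < 1.
Proof.
by rewrite invr_ge0 ler0n /= invf_lt1 ?ltr0n ?prime_gt0 // ltr1n prime_gt1.
Qed.

(** By Bezout, otherwise 1 would be a difference of two elements of absolute value less than 1. *)
Lemma abs_coprime (k : nat) : ~~ (p %| k)%N -> abs k%:R = 1.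
Proof.
move=> pk; apply/eqP; rewrite eq_le (abs_nat_le1 CC) /= leNgt; apply/negP => k1.
have /(coprimeP _ (prime_gt0 p_prime)) [[u v] /= uv] : coprime p k.
  by rewrite prime_coprime.
have e1 : u%:R * p%:R = 1 + v%:R * k%:R :> C.
  rewrite -!natrM -(natrD _ 1); congr _%:R; lia.
have : abs 1 < 1.
  have -> : 1 = u%:R * p%:R - v%:R * k%:R :> C by rewrite e1 addrK.
  apply: (abs_ltB CC); rewrite (absM CC).
    rewrite (le_lt_trans _ (proj2 (andP invp_itv))) // -(Cp_absp CC).
    by rewrite ler_piMl ?(abs_ge0 CC) ?(abs_nat_le1 CC).
  by rewrite (le_lt_trans _ k1) // ler_piMl ?(abs_ge0 CC) ?(abs_nat_le1 CC).
by rewrite (abs1 CC) ltxx.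
Qed.

Lemma abs_natp (k : nat) : (p %| k)%N -> abs k%:R <= p%:R^-1.
Proof.
move=> /dvdnP[m ->]; rewrite natrM (absM CC) (Cp_absp CC).
by rewrite ler_piMl ?invr_ge0 // (abs_nat_le1 CC).
Qed.

Lemma natC_neq0 (k : nat) : (0 < k)%N -> k%:R != 0 :> C.
Proof.
move=> k0; have [m] := pfactor_coprime p_prime k0.
rewrite prime_coprime // => pm ->; rewrite natrM natrX.
rewrite mulf_neq0 ?expf_neq0 ?p_neq0 //; apply/eqP => m0.
have := abs_coprime pm; rewrite m0 (abs0 CC) => /eqP.
by rewrite eq_sym oner_eq0.
Qed.

Lemma abs_absz (m : int) : abs m%:~R = abs `|m|%N%:R.
Proof. by case: m => k //; rewrite NegzE rmorphN /= (absN CC). Qed.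

(** In lowest terms [p] divides at most one of numerator and denominator. *)
Lemma abs_rat (y : rat) : abs (ratr y) < 1 -> abs (ratr y) <= p%:R^-1.
Proof.
rewrite /ratr (absM CC) (absV CC) !abs_absz => y1.
have d1 : ~~ (p %| `|denq y|)%N || ~~ (p %| `|numq y|)%N.
  rewrite -negb_and; apply/negP => /andP[pd pn].
  have := coprime_num_den y; rewrite /coprime => /eqP g1.
  have : (p %| 1)%N by rewrite -g1 dvdn_gcd pd pn.
  by rewrite dvdn1 => /eqP p1; move: p_prime; rewrite p1.
have [pn|pn] := boolP (p %| `|numq y|)%N.
  by rewrite pn orbF in d1; rewrite (abs_coprime d1) invr1 mulr1 abs_natp.
move: y1; rewrite (abs_coprime pn) mul1r ltNge invf_ge1 ?(abs_nat_le1 CC) //.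
by rewrite (abs_gt0 CC) // natC_neq0 // absz_gt0 denq_neq0.
Qed.

(** A rational close enough to a nonzero limit has the same absolute value. *)
Lemma Qp_abs y : Qp abs y -> abs y < 1 -> abs y <= p%:R^-1.
Proof.
move=> [u /(cvg_absP CC) h] y1.
have [->|y0] := eqVneq y 0; first by rewrite (abs0 CC); case/andP: invp_itv.
have [N /(_ _ (leqnn N)) hN] := h _ (abs_gt0 CC y0).
have uE : abs (ratr (u N)) = abs y.
  by rewrite -[ratr (u N)](subrKC y) (abs_domD CC).
by rewrite -uE abs_rat // uE.
Qed.

Variables (n a : nat) (Qq : set C) (Fq : finFieldType) (red : C -> Fq).
Variables gam gt : C.
Hypothesis n_gt0 : (0 < n)%N.
Hypotheses (Qq_unramified : is_Qq abs a Qq).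
Hypotheses (red_residue : is_residue_map abs Qq red).
Hypothesis gam_root :
  cvg_abs abs (psum (fun k => gam ^+ (p ^ k) / p%:R ^+ k)) 0.
Hypothesis gam_ord : ordp abs p gam = 1 / (p - 1)%N%:R.
Hypothesis gt_root : gt ^+ n = gam.

Local Notation O := (integers abs Qq).
Local Notation A := (adjoin O gt).
Local Notation e := (n * (p - 1))%N.
Local Notation r := (abs gt).

Lemma Qq_ring : [/\ Qq 1, forall x y, Qq x -> Qq y -> Qq (x - y) &
  forall x y, Qq x -> Qq y -> Qq (x / y)].
Proof.
case: Qq_unramified => -[h1 h2 h3] _ _ _; split; first by move: h1; rewrite inE.
  by move=> x y hx hy; have := h2 x y; rewrite !inE; apply.
by move=> x y hx hy; have := h3 x y; rewrite !inE; apply.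
Qed.

Lemma Qq0 : Qq 0.
Proof. by case: Qq_ring => h1 hB _; rewrite -(subrr 1); apply: hB. Qed.

Lemma O_1 : O 1.
Proof. by split; [case: Qq_ring | rewrite (abs1 CC)]. Qed.

Lemma O_0 : O 0.
Proof. by split; [exact: Qq0 | rewrite (abs0 CC) ler01]. Qed.

Lemma O_B x y : O x -> O y -> O (x - y).
Proof.
case: Qq_ring => _ hB _ [Kx x1] [Ky y1].
by split; [exact: hB | exact: (abs_leB CC)].
Qed.

Lemma O_N x : O x -> O (- x).
Proof. by move=> Ox; rewrite -sub0r; apply: O_B => //; apply: O_0. Qed.

Lemma O_D x y : O x -> O y -> O (x + y).
Proof. by move=> Ox Oy; rewrite -[y]opprK; apply: O_B => //; apply: O_N. Qed.

Lemma O_M x y : O x -> O y -> O (x * y).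
Proof.
case: Qq_ring => h1 hB hV [Kx x1] [Ky y1]; split; last first.
  by rewrite (absM CC) mulr_ile1 ?(abs_ge0 CC).
by rewrite -[y]invrK; apply: (hV) => //; rewrite -div1r; apply: (hV).
Qed.

Lemma O_V x : O x -> abs x = 1 -> O x^-1.
Proof.
case: Qq_ring => h1 hB hV [Kx _] x1.
by rewrite -div1r; split; [exact: hV | rewrite mul1r (absV CC) x1 invr1].
Qed.

Lemma O_sum (I : Type) (s : seq I) (P : pred I) (F : I -> C) :
  (forall i, P i -> O (F i)) -> O (\sum_(i <- s | P i) F i).
Proof. by move=> hF; elim/big_ind: _ => //; [exact: O_0 | exact: O_D]. Qed.

Lemma O_nat k : O k%:R.
Proof.
by elim: k => [|k IH]; [exact: O_0 | rewrite -natr1; apply: O_D => //; exact: O_1].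
Qed.

(** By unramifiedness a nonzero [c] has the absolute value of an element of Q_p, which cannot lie
    strictly between 1/p and 1. *)
Lemma O_divp c : O c -> abs c < 1 -> O (c / p%:R).
Proof.
move=> [Kc _] c1; split; first by case: Qq_ring => _ _; apply=> //; case: (O_nat p).
rewrite (absM CC) (absV CC) (Cp_absp CC) invrK.
have [->|c0] := eqVneq c 0; first by rewrite (abs0 CC) mul0r ler01.
rewrite -ler_pdivlMr ?ltr0n ?prime_gt0 // div1r.
case: Qq_unramified => _ _ _ /(_ _ Kc c0) [y [Ky cy]].
by rewrite cy Qp_abs // -cy.
Qed.

Lemma A_O c : O c -> A c.
Proof.
move=> Oc; exists c%:P; last by rewrite hornerC.
by move=> i; rewrite coefC; case: ifP => // _; apply: O_0.
Qed.

Lemma A_gt : A gt.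
Proof.
exists 'X; last by rewrite hornerX.
by move=> i; rewrite coefX; apply: O_nat.
Qed.

Lemma A_B x y : A x -> A y -> A (x - y).
Proof.
move=> [P hP ->] [Q hQ ->]; exists (P - Q); last by rewrite hornerD hornerN.
by move=> i; rewrite coefB; apply: O_B.
Qed.

Lemma A_M x y : A x -> A y -> A (x * y).
Proof.
move=> [P hP ->] [Q hQ ->]; exists (P * Q); last by rewrite hornerM.
by move=> i; rewrite coefM; apply: O_sum => j _; apply: O_M.
Qed.

Lemma A_1 : A 1. Proof. exact/A_O/O_1. Qed.
Lemma A_0 : A 0. Proof. exact/A_O/O_0. Qed.

Lemma A_N x : A x -> A (- x).
Proof. by move=> Ax; rewrite -sub0r; apply: A_B => //; apply: A_0. Qed.

Lemma A_D x y : A x -> A y -> A (x + y).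
Proof. by move=> Ax Ay; rewrite -[y]opprK; apply: A_B => //; apply: A_N. Qed.

Lemma A_sum (I : Type) (s : seq I) (P : pred I) (F : I -> C) :
  (forall i, P i -> A (F i)) -> A (\sum_(i <- s | P i) F i).
Proof. by move=> hF; elim/big_ind: _ => //; [exact: A_0 | exact: A_D]. Qed.

Lemma A_X x k : A x -> A (x ^+ k).
Proof.
by move=> Ax; elim: k => [|k IH]; rewrite ?expr0 ?exprS; [exact: A_1 | exact: A_M].
Qed.

Lemma A_split m x : A x -> exists (c : nat -> C) y,
  [/\ forall j, O (c j), A y & x = \sum_(j < m) c j * gt ^+ j + gt ^+ m * y].
Proof.
move=> [P hP ->]; exists (fun j => P`_j), (drop_poly m P).[gt]; split=> //.
  by exists (drop_poly m P) => // i; rewrite coef_drop_poly.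
rewrite -{1}(poly_take_drop m P) hornerD hornerM hornerXn mulrC; congr (_ + _).
rewrite (@horner_coef_wide _ m) ?size_take_poly //.
by apply: eq_bigr => j _; rewrite coef_take_poly ltn_ord.
Qed.

Lemma gam_pow : abs gam ^+ (p - 1) = p%:R^-1.
Proof.
have p1 := prime_gt1 p_prime.
have q0 : (p - 1)%N%:R != 0 :> R by rewrite pnatr_eq0; lia.
have lp : 0 < ln (p%:R : R) by rewrite ln_gt0 // ltr1n.
have g0 : 0 < abs gam.
  (* For [gam = 0] the convention [ln 0 = 0] would give order 0 instead of 1/(p-1). *)
  rewrite lt_neqAle (abs_ge0 CC) andbT eq_sym; apply/eqP => g0.
  move: gam_ord; rewrite /ordp g0 ln0 // oppr0 mul0r => /esym/eqP.
  by rewrite mul1r invr_eq0 (negbTE q0).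
apply: ln_inj; rewrite ?posrE ?exprn_gt0 ?invr_gt0 ?ltr0n ?prime_gt0 //.
rewrite lnXn // lnV ?posrE ?ltr0n ?prime_gt0 //.
have : ln (abs gam) = - (ln (p%:R : R) / (p - 1)%N%:R).
  have := congr1 (fun z => - (z * ln p%:R)) gam_ord.
  rewrite /ordp divfK ?gt_eqF // opprK => ->; congr (- _).
  by rewrite mul1r mulrC.
by move=> ->; rewrite mulNrn -[_ / _ *+ _]mulr_natr divfK.
Qed.

Lemma r_pow : r ^+ e = p%:R^-1.
Proof. by rewrite exprM -(absX CC) gt_root gam_pow. Qed.

Lemma e_gt0 : (0 < e)%N.
Proof. by rewrite muln_gt0 n_gt0 subn_gt0 prime_gt1. Qed.

Lemma r_itv : 0 < r < 1.
Proof.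
have r0 : 0 < r.
  rewrite lt_neqAle (abs_ge0 CC) andbT; apply/eqP => r0.
  have := r_pow; rewrite -r0 expr0n gtn_eqF ?e_gt0 // => /eqP.
  by rewrite eq_sym invr_eq0 pnatr_eq0 gtn_eqF // prime_gt0.
rewrite r0 ltNge; apply/negP => r1.
have := exprn_ege1 e r1; rewrite r_pow leNgt.
by case/andP: invp_itv => _ ->.
Qed.

Lemma r_gt0 : 0 < r. Proof. by case/andP: r_itv. Qed.
Lemma r_lt1 : r < 1. Proof. by case/andP: r_itv. Qed.
Lemma r01 : 0 <= r < 1. Proof. by rewrite (ltW r_gt0) r_lt1. Qed.

Lemma gt_neq0 : gt != 0.
Proof. by apply/eqP => g0; have := r_gt0; rewrite g0 (abs0 CC) ltxx. Qed.

Lemma A_le1 x : A x -> abs x <= 1.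
Proof.
move=> [P hP ->]; rewrite horner_coef (abs_le_sum CC) ?ler01 // => i _.
rewrite (absM CC) (absX CC) mulr_ile1 ?exprn_ge0 ?(abs_ge0 CC) //.
  by have [] := hP i.
by rewrite exprn_ile1 ?(abs_ge0 CC) // ltW // r_lt1.
Qed.

(* In terms of [w], the equation satisfied by [gam] becomes
   [w = 1 + \sum_(k >= 2) (- w)^k gam^(p^k - (p - 1) k - 1)], with positive
   exponents; it determines [w] as the fixed point of a contraction. *)
Definition gam_unit := - (gam ^+ (p - 1) / p%:R).
Definition gam_exp k := (p ^ k.+2 - (p - 1) * k.+2 - 1)%N.
Local Notation w := gam_unit.
Local Notation ex := gam_exp.

Lemma gam_neq0 : gam != 0.
Proof. by rewrite -gt_root expf_neq0 // gt_neq0. Qed.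

Lemma abs_w : abs w = 1.
Proof.
rewrite /gam_unit (absN CC) (absM CC) (absX CC) gam_pow (absV CC) (Cp_absp CC).
by rewrite divff // invr_eq0 pnatr_eq0 gtn_eqF // prime_gt0.
Qed.

Lemma w_neq0 : w != 0.
Proof.
by apply/eqP => w0; have := abs_w; rewrite w0 (abs0 CC) => /eqP; rewrite eq_sym oner_eq0.
Qed.

Lemma bernoulli_nat k : ((p - 1) * k < p ^ k)%N.
Proof.
have p1 := prime_gt1 p_prime; elim: k => [|k IH]; first by rewrite muln0.
by rewrite expnS; nia.
Qed.

Lemma ex_gt0 k : (0 < ex k)%N.
Proof.
have p1 := prime_gt1 p_prime; have := bernoulli_nat k.+1.
rewrite /gam_exp (expnS p k.+1); nia.
Qed.

Lemma gam_term k : gam ^+ (p ^ k) / p%:R ^+ k =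
  (- w) ^+ k * gam ^+ (p ^ k - (p - 1) * k).
Proof.
rewrite /gam_unit opprK exprMn exprVn mulrAC -exprM -exprD subnKC //.
exact/ltnW/bernoulli_nat.
Qed.

Lemma w_equation (d : R) : 0 < d -> exists K,
  abs (1 - w + \sum_(k < K) (- w) ^+ k.+2 * gam ^+ ex k) < d.
Proof.
move=> d0; have g0 := abs_gt0 CC gam_neq0.
have := gam_root; move/(cvg_absP CC)/(_ _ (mulr_gt0 d0 g0)) => [N].
move=> /(_ N.+2 (leqW (leqW (leqnn _)))); rewrite subr0 => h.
exists N; rewrite -(ltr_pM2r g0) -(absM CC); apply: le_lt_trans h.
rewrite le_eqVlt; apply/orP; left; apply/eqP; congr abs.
(* The terms of index 0 and 1 are [gam] and [- w * gam], so the partial sum is [gam] times the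
   expression to be bounded. *)
rewrite /psum 2!big_ord_recl /= /bump /= expn0 expr0 divr1 expr1 gam_term.
rewrite !expr1 muln1 expn1 subKn ?prime_gt0 // expr1.
rewrite mulrDl mulrBl mul1r -mulNr -!addrA; congr (_ + (_ + _)).
rewrite mulr_suml; apply: eq_bigr => k _.
rewrite !add1n gam_term -mulrA -exprSr; congr (_ * _ ^+ _).
have := ex_gt0 k; rewrite /gam_exp; lia.
Qed.

(** * The closure of Z_q[gt] and division by [gt] *)

Definition near_A m x := exists2 y, A y & abs (x - y) <= r ^+ m.
Definition clos x := forall m, near_A m x.

Lemma abs_subX x y k : abs x <= 1 -> abs y <= 1 ->
  abs (x ^+ k - y ^+ k) <= abs (x - y).
Proof.
move=> x1 y1; rewrite subrXX (absM CC) ler_piMr ?(abs_ge0 CC) //.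
rewrite (abs_le_sum CC) ?ler01 // => i _.
by rewrite (absM CC) !(absX CC) mulr_ile1 ?exprn_ge0 ?exprn_ile1 ?(abs_ge0 CC).
Qed.

Lemma abs_subNX x y k : abs x <= 1 -> abs y <= 1 ->
  abs ((- x) ^+ k - (- y) ^+ k) <= abs (x - y).
Proof.
rewrite -(absN CC x) -(absN CC y) => x1 y1.
by have := abs_subX k x1 y1; rewrite opprK [- x + y]addrC (abs_distC CC y).
Qed.

Lemma abs_gamX k : (0 < k)%N -> abs (gam ^+ k) <= r.
Proof.
move=> k0; rewrite (absX CC) -gt_root (absX CC) -exprM.
rewrite -{2}[r]expr1 ler_wiXn2l ?ltW ?r_gt0 ?r_lt1 //.
by rewrite muln_gt0 n_gt0.
Qed.

Lemma A_gam : A gam.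
Proof. by rewrite -gt_root; apply: A_X; apply: A_gt. Qed.

(** Inserting an approximation modulo gt^m into the fixed point equation gives one modulo gt^(m+1),
    since each [gam ^+ ex k] is divisible by [gt]. *)
Lemma clos_w : clos w.
Proof.
elim=> [|m [y Ay wy]].
  by exists 0; [exact: A_0 | rewrite subr0 abs_w expr0].
have [K hK] := w_equation (exprn_gt0 m.+1 r_gt0).
exists (1 + \sum_(k < K) (- y) ^+ k.+2 * gam ^+ ex k).
  apply: A_D; first exact: A_1.
  apply: A_sum => k _; apply: A_M; apply: A_X; last exact: A_gam.
  exact: A_N.
rewrite (_ : w - _ = \sum_(k < K) ((- w) ^+ k.+2 - (- y) ^+ k.+2) * gam ^+ ex k
  - (1 - w + \sum_(k < K) (- w) ^+ k.+2 * gam ^+ ex k)); last first.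
  under [X in _ = X - _]eq_bigr do rewrite mulrBl.
  by rewrite sumrB; ring.
apply: (abs_leB CC); last exact: ltW.
rewrite (abs_le_sum CC) ?exprn_ge0 ?(abs_ge0 CC) // => k _.
rewrite (absM CC) [r ^+ _]exprSr ler_pM ?(abs_ge0 CC) ?abs_gamX ?ex_gt0 //.
by rewrite (le_trans _ wy) // abs_subNX ?abs_w ?A_le1.
Qed.

(** Dividing the equation of [w] by [w] shows that [w^-1] is the limit of 1 + sum_k (-w)^(k+1)
    gam^(ex k), so approximations of [w] give approximations of its inverse. *)
Lemma clos_wV : clos w^-1.
Proof.
move=> m; have [y Ay wy] := clos_w m.
have [K hK] := w_equation (exprn_gt0 m r_gt0).
exists (1 + \sum_(k < K) (- y) ^+ k.+1 * gam ^+ ex k).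
  apply: A_D; first exact: A_1.
  apply: A_sum => k _; apply: A_M; apply: A_X; last exact: A_gam.
  exact: A_N.
rewrite (_ : w^-1 - _ = \sum_(k < K) ((- w) ^+ k.+1 - (- y) ^+ k.+1) * gam ^+ ex k
  + w^-1 * (1 - w + \sum_(k < K) (- w) ^+ k.+2 * gam ^+ ex k)); last first.
  have wK X g : w^-1 * (- w * X * g) = - (X * g) by field; apply: w_neq0.
  under [X in _ = X + _]eq_bigr do rewrite mulrBl.
  rewrite sumrB mulrDr mulrBr mulVf ?w_neq0 // mulr1 mulr_sumr.
  under [X in _ = _ + (_ + X)]eq_bigr do
    rewrite exprS wK.
  by rewrite sumrN; ring.
apply: (abs_leD CC); last first.
  by rewrite (absM CC) (absV CC) abs_w invr1 mul1r ltW.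
rewrite (abs_le_sum CC) ?exprn_ge0 ?(abs_ge0 CC) // => k _.
rewrite (absM CC) -[r ^+ m]mulr1 ler_pM ?(abs_ge0 CC) //.
  by rewrite (le_trans _ wy) // abs_subNX ?abs_w ?A_le1.
by rewrite (le_trans (abs_gamX _)) ?ex_gt0 // ltW // r_lt1.
Qed.

Lemma clos_le1 x : clos x -> abs x <= 1.
Proof.
move=> /(_ 0%N) [y Ay]; rewrite expr0 => xy.
by rewrite -[x](subrK y) (abs_leD CC) // A_le1.
Qed.

Lemma clos_A x : A x -> clos x.
Proof. by move=> Ax m; exists x => //; rewrite subrr (abs0 CC) exprn_ge0 // (abs_ge0 CC). Qed.

Lemma clos_D x y : clos x -> clos y -> clos (x + y).
Proof.
move=> cx cy m; have [x' Ax xx'] := cx m; have [y' Ay yy'] := cy m.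
exists (x' + y'); first exact: A_D.
by rewrite opprD addrACA (abs_leD CC).
Qed.

Lemma clos_M x y : clos x -> clos y -> clos (x * y).
Proof.
move=> cx cy m; have [x' Ax xx'] := cx m; have [y' Ay yy'] := cy m.
exists (x' * y'); first exact: A_M.
have -> : x * y - x' * y' = (x - x') * y + x' * (y - y') by ring.
apply: (abs_leD CC); rewrite (absM CC).
  by rewrite -[r ^+ m]mulr1 ler_pM ?(abs_ge0 CC) ?clos_le1.
by rewrite -[r ^+ m]mul1r ler_pM ?(abs_ge0 CC) ?A_le1.
Qed.

Lemma clos_N x : clos x -> clos (- x).
Proof. by rewrite -mulN1r; apply: clos_M; apply: clos_A; apply: A_N; apply: A_1. Qed.

Lemma pE : p%:R = - (gt ^+ e * w^-1).
Proof.
rewrite /gam_unit -gt_root -exprM invrN mulrN opprK invfM invrK mulVKf //.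
by rewrite expf_neq0 // gt_neq0.
Qed.

Lemma gtXE : gt ^+ e = - (p%:R * w).
Proof. by rewrite pE mulNr mulfVK ?w_neq0 // opprK. Qed.

(** Modulo [gt], [x] is an integer of Q_q; being small it is divisible by [p], and p / gt = -
    gt^(e-1) w^-1 is already in the closure. *)
Lemma clos_div x : clos x -> abs x < 1 -> clos (x / gt).
Proof.
move=> cx x1 m; have [y Ay xy] := cx m.+1.
have [c [y' [Oc Ay' yE]]] := A_split 1 Ay.
rewrite big_ord1 expr0 mulr1 expr1 in yE.
have c1 : abs (c 0%N) < 1.
  have -> : c 0%N = x - (x - y) - gt * y' by rewrite yE; ring.
  apply: (abs_ltB CC); first apply: (abs_ltB CC) => //.
    by rewrite (le_lt_trans xy) // exprn_ilt1 // ?r_lt1 // ltW // r_gt0.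
  rewrite (absM CC) (le_lt_trans _ r_lt1) // ler_piMr ?(abs_ge0 CC) //.
  exact: A_le1.
have ccl : clos (c 0%N / gt + y').
  apply: clos_D; last exact: clos_A.
  have -> : c 0%N / gt = c 0%N / p%:R * - (gt ^+ e.-1 * w^-1).
    have <- : p%:R / gt = - (gt ^+ e.-1 * w^-1).
      rewrite pE -{1}(prednK e_gt0) exprS -mulrA -mulNr [_ / _]mulrC mulNr mulrN.
      by rewrite mulKf // gt_neq0.
    by rewrite mulrA divfK // p_neq0.
  apply: clos_M; first by apply/clos_A/A_O/O_divp.
  apply/clos_N/clos_M; last exact: clos_wV.
  by apply/clos_A/A_X/A_gt.
have [z Az hz] := ccl m; exists z => //.
have -> : x / gt - z = (x - y) / gt + (c 0%N / gt + y' - z).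
  by rewrite yE; field; apply: gt_neq0.
apply: (abs_leD CC) => //.
by rewrite (absM CC) (absV CC) ler_pdivrMr ?r_gt0 // -exprSr.
Qed.

Lemma clos_divX m x : clos x -> abs x <= r ^+ m -> clos (x / gt ^+ m).
Proof.
elim: m x => [|m IH] x cx; first by rewrite expr0 divr1.
move=> xm; rewrite exprS invfM mulrA; apply: IH.
  apply: clos_div => //; rewrite (le_lt_trans xm) // exprn_ilt1 ?r_lt1 //.
  exact/ltW/r_gt0.
by rewrite (absM CC) (absV CC) ler_pdivrMr ?r_gt0 // -exprSr.
Qed.

Lemma red_section : exists T : Fq -> C, forall f, O (T f) /\ red (T f) = f.
Proof.
case: red_residue => _ _ _ _ h.
have /choice [T hT] : forall f, exists x, O x /\ red x = f.
  by move=> f; have [x ? ?] := h f; exists x.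
by exists T.
Qed.

Lemma abs_sub_lift T c : (forall f, O (T f) /\ red (T f) = f) -> O c ->
  abs (c - T (red c)) < 1.
Proof.
move=> hT Oc; have [OT rT] := hT (red c); case: red_residue => _ rD _ r0 _.
apply/r0; first exact: O_B.
have := rD _ _ (O_B Oc OT) OT; rewrite subrK rT => /esym/eqP.
by rewrite -subr_eq0 addrK => /eqP.
Qed.

(** One power of [p] accounts for [e] digits in [gt]: replacing a coefficient by its representative
    costs a multiple of [p], and gt^e = - p w. *)
Lemma clos_digits T x : (forall f, O (T f) /\ red (T f) = f) -> clos x ->
  exists (d : 'I_e -> Fq) x', clos x' /\
    x = \sum_(j < e) T (d j) * gt ^+ j + p%:R * x'.
Proof.
move=> hT cx; have [y Ay xy] := cx e.
have [c [y1 [Oc Ay1 yE]]] := A_split e Ay.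
pose c' j := (c j - T (red (c j))) / p%:R.
have Oc' j : O (c' j).
  apply: O_divp; last exact: abs_sub_lift.
  by apply: O_B => //; case: (hT (red (c j))).
exists (fun j => red (c j)).
exists (\sum_(j < e) c' j * gt ^+ j - w * (y1 + (x - y) / gt ^+ e)); split.
  apply: clos_D.
    by apply/clos_A/A_sum => j _; apply: A_M; [apply: A_O | apply/A_X/A_gt].
  apply/clos_N/clos_M; first exact: clos_w.
  apply: clos_D; first exact: clos_A.
  by apply: clos_divX => //; apply: clos_D => //; apply/clos_N/clos_A.
have yE' : y = \sum_(j < e) T (red (c j)) * gt ^+ j
    + p%:R * \sum_(j < e) c' j * gt ^+ j + gt ^+ e * y1.
  rewrite {1}yE mulr_sumr -big_split /=; congr (_ + _); apply: eq_bigr => j _.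
  by rewrite /c' mulrA -mulrDl; congr (_ * _); field; apply: p_neq0.
have gE : gt ^+ e != 0 by rewrite expf_neq0 ?gt_neq0.
have xE : x = y + gt ^+ e * ((x - y) / gt ^+ e) by field.
rewrite {1}xE {1}yE' gtXE; ring.
Qed.

(* Collecting equal digits turns the p-adic expansion of [x] into a finite
   combination of elements of [Qp], which gives completeness of [A] without
   any appeal to the dimension of [Qq] over [Qp]. *)
Lemma A_closed x : clos x -> A x.
Proof.
move=> cx; have [T hT] := red_section.
have /choice [D hD] : forall x, exists D : ('I_e -> Fq) * C, clos x -> clos D.2 /\
    x = \sum_(j < e) T (D.1 j) * gt ^+ j + p%:R * D.2.
  move=> z; have [cz|ncz] := pselect (clos z).
    by have [d [z' ?]] := clos_digits hT cz; exists (d, z').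
  by exists (fun=> 0, 0).
pose xk := fix xk k := if k is k'.+1 then (D (xk k')).2 else x.
pose d k := (D (xk k)).1.
have cxk k : clos (xk k) by elim: k => //= k /hD [].
have xE K : x = \sum_(k < K) p%:R ^+ k * (\sum_(j < e) T (d k j) * gt ^+ j)
    + p%:R ^+ K * xk K.
  elim: K => [|K IH]; first by rewrite big_ord0 expr0 add0r mul1r.
  rewrite {1}IH big_ord_recr /= -addrA; congr (_ + _).
  by have [_ {1}->] := hD _ (cxk K); rewrite mulrDr mulrA exprSr.
(* [u f j] marks the places where the digit at gt^j is [f]. Its sum [S (f, j)] is a limit of natural
   numbers, hence lies in Q_p. *)
pose u f j k : C := (d k j == f)%:R * p%:R ^+ k.
have hu f j k : abs (u f j k) <= 1 * (p%:R^-1 : R) ^+ k.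
  rewrite mul1r (absM CC) (absX CC) (Cp_absp CC) ler_piMl ?exprn_ge0 ?invr_ge0 //.
  exact: abs_nat_le1 CC _.
have /choice [S hS] : forall fj, exists l, forall N,
    abs (psum (u fj.1 fj.2) N - l) <= 1 * (p%:R^-1 : R) ^+ N.
  by move=> fj; apply: (series_geom CC invp_itv ler01).
have OS fj : O (S fj).
  split; last first.
    by have := hS fj 0%N; rewrite /psum big_ord0 sub0r (absN CC) expr0 mulr1.
  case: Qq_unramified => _ QpQq _ _; apply: QpQq.
  exists (fun N => (\sum_(k < N) (d k fj.2 == fj.1) * p ^ k)%N%:R).
  apply: (geom_cvg CC invp_itv (b := 1)) => N; rewrite (le_trans _ (hS fj N)) //.
  rewrite ratr_nat natr_sum le_eqVlt; apply/orP; left; apply/eqP.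
  congr (abs (_ - _)); apply: eq_bigr => k _.
  by rewrite natrM natrX.
pose y := \sum_(j < e) (\sum_f T f * S (f, j)) * gt ^+ j.
have Ay : A y.
  apply: A_sum => j _; apply: A_M; last exact/A_X/A_gt.
  by apply/A_O/O_sum => f _; apply: O_M => //; case: (hT f).
suff -> : x = y by [].
apply/eqP; rewrite -subr_eq0; apply/eqP.
apply: (abs_eq0_geom CC (b := 1) invp_itv) => K.
have -> : x - y = \sum_(j < e) (\sum_f T f * (psum (u f j) K - S (f, j))) * gt ^+ j
    + p%:R ^+ K * xk K.
  rewrite {1}(xE K) addrAC; congr (_ + _).
  under [RHS]eq_bigr do under eq_bigr do rewrite mulrBr.
  under [RHS]eq_bigr do rewrite sumrB mulrBl.
  rewrite sumrB; congr (_ - _).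
  under eq_bigr do rewrite mulr_sumr.
  rewrite exchange_big; apply: eq_bigr => j _ /=.
  rewrite /psum; under [in RHS]eq_bigr do rewrite mulr_sumr.
  rewrite exchange_big /= mulr_suml; apply: eq_bigr => k _.
  rewrite (bigD1 (d k j)) //= big1 => [|f fd].
    by rewrite /u eqxx mul1r addr0; ring.
  by rewrite /u eq_sym (negbTE fd) mul0r mulr0.
have q0 : 0 <= 1 * (p%:R^-1 : R) ^+ K by rewrite mul1r exprn_ge0 // invr_ge0.
apply: (abs_leD CC).
  apply: (abs_le_sum CC) => // j _; rewrite (absM CC) -[leRHS]mulr1.
  rewrite ler_pM ?(abs_ge0 CC) //; last by apply/A_le1/A_X/A_gt.
  apply: (abs_le_sum CC) => // f _; rewrite (absM CC) -[leRHS]mul1r.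
  by rewrite ler_pM ?(abs_ge0 CC) ?(hS (f, j)) //; case: (hT f) => -[].
rewrite (absM CC) (absX CC) (Cp_absp CC) mulrC.
by rewrite ler_pM ?(abs_ge0 CC) ?exprn_ge0 ?invr_ge0 ?clos_le1.
Qed.

Lemma A_divX m x : A x -> abs x <= r ^+ m -> A (x / gt ^+ m).
Proof. by move=> Ax xm; apply/A_closed/clos_divX => //; apply: clos_A. Qed.

(** With x = c0 + gt y, the inverse is the fixed point of z -> c0^-1 (1 - gt y z), a contraction of
    ratio at most [abs gt]. *)
Lemma A_V x : A x -> abs x = 1 -> A x^-1.
Proof.
move=> Ax x1; have x0 : x != 0.
  by apply/eqP => x0; move: x1; rewrite x0 (abs0 CC) => /eqP; rewrite eq_sym oner_eq0.
have [c [y [Oc Ay xE]]] := A_split 1 Ax.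
rewrite big_ord1 expr0 mulr1 expr1 in xE.
have c1 : abs (c 0%N) = 1.
  rewrite -x1 xE (abs_domD CC) //.
  have gy : abs (gt * y) < 1.
    rewrite (absM CC) (le_lt_trans _ r_lt1) // ler_piMr ?(abs_ge0 CC) //.
    exact: A_le1.
  rewrite -[c 0%N](addrK (gt * y)) -xE (abs_domD CC) ?(absN CC) ?x1 //.
have c0 : c 0%N != 0.
  by apply/eqP => z0; move: c1; rewrite z0 (abs0 CC) => /eqP; rewrite eq_sym oner_eq0.
have AV : A (c 0%N)^-1 by apply/A_O/O_V.
apply: A_closed; elim=> [|m [z Az hz]].
  by exists 0; [exact: A_0 | rewrite subr0 (absV CC) x1 invr1 expr0].
exists ((c 0%N)^-1 * (1 - gt * y * z)).
  apply: A_M => //; apply: A_B; first exact: A_1.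
  by apply: A_M => //; apply: A_M => //; apply: A_gt.
have -> : x^-1 - (c 0%N)^-1 * (1 - gt * y * z) =
    - ((c 0%N)^-1 * y * (gt * (x^-1 - z))).
  have gyE : gt * y = x - c 0%N by rewrite xE; ring.
  have -> : (c 0%N)^-1 * y * (gt * (x^-1 - z)) =
      (c 0%N)^-1 * ((gt * y) * (x^-1 - z)) by ring.
  by rewrite gyE; field; rewrite x0.
rewrite (absN CC) (absM CC) -[leRHS]mul1r ler_pM ?(abs_ge0 CC) //.
  by apply: A_le1; apply: A_M.
by rewrite (absM CC) exprS ler_pM ?(abs_ge0 CC).
Qed.

Lemma A_lt1 x : A x -> abs x < 1 -> abs x <= r.
Proof.
move=> Ax x1; have := clos_le1 (clos_div (clos_A Ax) x1).
by rewrite (absM CC) (absV CC) ler_pdivrMr ?r_gt0 // mul1r.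
Qed.

Lemma adjoin_unif_ring : is_unif_ring abs A gt.
Proof.
split; [exact: A_1 | exact: A_B | exact: A_M | exact: A_gt | exact: r_itv
  | exact: A_le1 | exact: A_closed | exact: A_divX | exact: A_lt1 | exact: A_V].
Qed.

(** * Size and integrality of the coefficients of the operators *)

Lemma A_gammai i : A (gammai p gam i * p%:R ^+ i).
Proof.
rewrite /gammai mulr_suml; apply: A_sum => k _.
have ki : (k <= i)%N by rewrite -ltnS.
have -> : p%:R ^+ i = p%:R ^+ k * p%:R ^+ (i - k) :> C by rewrite -exprD subnKC.
rewrite mulrA divfK ?expf_neq0 ?p_neq0 //.
by apply: A_M; apply: A_X; [exact: A_gam | apply/A_O/O_nat].
Qed.

(** By [gam_term], p^k - (p-1) k is the order, in units of that of [gam], of the k-th term of the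
    series with root [gam]. *)
Lemma pow_sub_mono i k : (i <= k)%N ->
  (p ^ i - (p - 1) * i <= p ^ k - (p - 1) * k)%N.
Proof.
have p1 := prime_gt1 p_prime; elim: k => [|k IH]; first by rewrite leqn0 => /eqP ->.
rewrite leq_eqVlt => /orP[/eqP -> //|]; rewrite ltnS => /IH ik.
apply: leq_trans ik _; have := bernoulli_nat k; have := bernoulli_nat k.+1.
have : (0 < p ^ k)%N by rewrite expn_gt0 ltnW.
by rewrite expnS; nia.
Qed.

(* [gammai p gam i] is a partial sum of a series with sum 0, so it is as small as
   the first omitted term. *)
Lemma abs_gammai i : abs (gammai p gam i * p%:R ^+ i) <= r ^+ (n * p ^ i + i).
Proof.
have p1 := prime_gt1 p_prime; have g0 := abs_gt0 CC gam_neq0.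
have gr : abs gam = r ^+ n by rewrite -gt_root (absX CC).
have g1 : abs gam <= 1 by rewrite gr exprn_ile1 // ltW ?r_gt0 ?r_lt1.
set u := fun k => gam ^+ (p ^ k) / p%:R ^+ k.
have absu k : abs (u k) = abs gam ^+ (p ^ k - (p - 1) * k).
  by rewrite /u gam_term (absM CC) !(absX CC) (absN CC) abs_w expr1n mul1r.
pose Y := abs gam ^+ (p ^ i.+1 - (p - 1) * i.+1).
have Y0 : 0 < Y by rewrite exprn_gt0.
have gY : abs (gammai p gam i) <= Y.
  have [N hN] := (cvg_absP CC _ _).1 gam_root _ Y0.
  have -> : gammai p gam i = psum u (i.+1 + N) - (psum u (i.+1 + N) - psum u i.+1).
    by rewrite subKr.
  apply: (abs_leB CC).
    by have := hN (i.+1 + N)%N (leq_addl _ _); rewrite subr0 => /ltW.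
  elim: (N) => [|m IH]; first by rewrite addn0 subrr (abs0 CC) ltW.
  rewrite addnS psumS addrAC (abs_leD CC) // absu ler_wiXn2l ?(abs_ge0 CC) //.
  by apply: pow_sub_mono; rewrite leq_addr.
rewrite (absM CC) (absX CC) (Cp_absp CC) -gam_pow -exprM.
apply: le_trans (_ : Y * abs gam ^+ ((p - 1) * i) <= _).
  by rewrite ler_wpM2r // exprn_ge0 // (abs_ge0 CC).
rewrite /Y -exprD gr -exprM ler_wiXn2l ?ltW ?r_gt0 ?r_lt1 //.
have := bernoulli_nat i.+1; have := bernoulli_nat i; rewrite expnS => h1 h2.
(* The exponent of [abs gam] collapses to p^(i+1) - (p-1), which is at least p^i + i: enough to pay
   for a shift of weight n p^i and to gain gt^i besides. *)
have e1 : (p * p ^ i - (p - 1) * i.+1 + (p - 1) * i = p * p ^ i - (p - 1))%N by nia.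
rewrite e1; have h3 : (p ^ i + i <= p * p ^ i - (p - 1))%N by nia.
by have := leq_mul (leqnn n) h3; nia.
Qed.

Lemma abs_gammai0 : abs (gammai p gam 0 * p%:R ^+ 0) = r ^+ n.
Proof.
by rewrite /gammai big_ord1 expn0 !expr0 divr1 mulr1 expr1 -gt_root (absX CC).
Qed.

(** On integers [sig] differs from the p-th power map by an element of absolute value less than 1,
    so it does not leave the unit ball. *)
Lemma A_frobenius (sig : C -> C) x k : is_frobenius abs p Qq sig -> O x ->
  A (iter k sig x).
Proof.
move=> [[sQ _ _ _] _ frob] Ox; apply: A_O; elim: k => //= k [Qk k1]; split.
  by rewrite -sQ; exists (iter k sig x).
rewrite -[sig _](subrK (iter k sig x ^+ p)); apply: (abs_leD CC).
  by apply/ltW/frob; split.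
by rewrite (absX CC) exprn_ile1 ?(abs_ge0 CC).
Qed.

Lemma abs_teich (t : Fq) tb : t != 0 -> is_teichmuller abs Qq red t tb ->
  abs tb = 1.
Proof.
move=> t0 [Otb rt _]; have [_ tb1] := Otb; case: red_residue => _ _ _ r0 _.
apply/eqP; rewrite eq_le tb1 leNgt; apply/negP => /r0 e.
by move: t0; rewrite -rt e // eqxx.
Qed.

End AdjoinedIntegers.

(** * The filtration of C0 by powers of gt *)

Section Filtration.
Variables (R : realType) (C : closedFieldType) (abs : C -> R) (p : nat).
Hypothesis CC : is_Cp abs p.
Variables (A : set C) (gt : C).
Hypothesis AU : is_unif_ring abs A gt.
Variable n : nat.
Hypothesis n_gt0 : (0 < n)%N.

Local Notation r := (abs gt).
Local Notation nw := (nw n).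

Let rgt0 : 0 < r. Proof. by case/andP: (ur_itv AU). Qed.
Let rge0 : 0 <= r. Proof. exact: ltW. Qed.
Let rlt1 : r < 1. Proof. by case/andP: (ur_itv AU). Qed.
Let r01 : 0 <= r < 1. Proof. by rewrite rge0. Qed.
Let gt0 : gt != 0.
Proof. by apply/eqP => g0; have := rgt0; rewrite g0 (abs0 CC) ltxx. Qed.

Lemma rX_gt0 k : 0 < r ^+ k. Proof. exact: exprn_gt0. Qed.
Lemma rX_le i j : (i <= j)%N -> r ^+ j <= r ^+ i.
Proof. by move=> ij; rewrite ler_wiXn2l // ltW. Qed.

Lemma ur_0 : A 0.
Proof. by rewrite -(subrr 1); apply: (ur_B AU); exact: (ur_1 AU). Qed.

Lemma ur_N x : A x -> A (- x).
Proof. by move=> Ax; rewrite -sub0r; apply: (ur_B AU) => //; apply: ur_0. Qed.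

Lemma ur_D x y : A x -> A y -> A (x + y).
Proof. by move=> Ax Ay; rewrite -[y]opprK; apply: (ur_B AU) => //; apply: ur_N. Qed.

Lemma ur_sum (I : Type) (s : seq I) (P : pred I) (F : I -> C) :
  (forall i, P i -> A (F i)) -> A (\sum_(i <- s | P i) F i).
Proof. by move=> hF; elim/big_ind: _ => //; [exact: ur_0 | exact: ur_D]. Qed.

Lemma ur_X x k : A x -> A (x ^+ k).
Proof.
move=> Ax; elim: k => [|k IH]; rewrite ?expr0 ?exprS; first exact: (ur_1 AU).
exact: (ur_M AU).
Qed.

Lemma ur_nat k : A k%:R.
Proof.
elim: k => [|k IH]; first exact: ur_0.
by rewrite -natr1; apply: ur_D => //; apply: (ur_1 AU).
Qed.

Lemma ur_int k : A k%:~R.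
Proof. by case: k => k; rewrite ?NegzE ?rmorphN; [|apply: ur_N]; apply: ur_nat. Qed.

(** The submodule gt^k C0, in terms of the coefficients [f u] rather than the normalised
    [xi u = f u / gt ^+ nw u]; the last clause is the decay of [xi]. *)
Definition inG (k : nat) (f : int * int -> C^o) : Prop :=
  [/\ forall u, A (f u), forall u, abs (f u) <= r ^+ (nw u + k) &
      forall m, exists M, forall u, (M <= nw u)%N -> abs (f u) <= r ^+ (nw u + m)].

Lemma inG_A k f u : inG k f -> A (f u). Proof. by case. Qed.

Lemma inG_le k f u : inG k f -> abs (f u) <= r ^+ (nw u + k).
Proof. by case. Qed.

Lemma inG_mono i j f : (i <= j)%N -> inG j f -> inG i f.
Proof.
move=> ij [hA hf hd]; split=> // u; rewrite (le_trans (hf u)) // rX_le //.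
by rewrite leq_add2l.
Qed.

Lemma inG_D k f g : inG k f -> inG k g -> inG k (f + g).
Proof.
move=> [hA hf hd] [hA' hf' hd']; split=> [u|u|m].
- exact: ur_D.
- exact: (abs_leD CC).
- have [M hM] := hd m; have [M' hM'] := hd' m; exists (maxn M M') => u.
  by rewrite geq_max => /andP[? ?]; apply: (abs_leD CC); [apply: hM | apply: hM'].
Qed.

Lemma inG_Z k c f : A c -> inG k f -> inG k (c *: f).
Proof.
move=> Ac [hA hf hd]; have hc x Y : abs x <= Y -> abs (c * x) <= Y.
  move=> xY; rewrite (absM CC) (le_trans _ xY) // ler_piMl ?(abs_ge0 CC) //.
  exact: (ur_le1 AU).
split=> [u|u|m]; [exact: (ur_M AU) | exact: hc |].
by have [M hM] := hd m; exists M => u Mu; apply/hc/hM.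
Qed.

Lemma inG_N k f : inG k f -> inG k (- f).
Proof. by move=> h; rewrite -scaleN1r; apply: inG_Z => //; apply/ur_N/(ur_1 AU). Qed.

Lemma inG_B k f g : inG k f -> inG k g -> inG k (f - g).
Proof. by move=> hf hg; apply: inG_D => //; apply: inG_N. Qed.

Lemma inG_0 k : inG k 0.
Proof.
by split=> [u|u|m]; [exact: ur_0 | | exists 0%N => u _];
  rewrite /= (abs0 CC) ltW // rX_gt0.
Qed.

Lemma inG_sum k (I : Type) (s : seq I) (P : pred I) F :
  (forall i, P i -> inG k (F i)) -> inG k (\sum_(i <- s | P i) F i).
Proof. by move=> hF; elim/big_ind: _ => //; [exact: inG_0 | exact: inG_D]. Qed.

(** The zero test behind the identities between limits below: they are checked modulo every power of
    [gt]. *)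
Lemma inG_sep f : (forall N, inG N f) -> f = 0.
Proof.
move=> h; apply/funext => u; apply: (abs_eq0_geom CC (b := 1) r01) => N.
by rewrite mul1r (le_trans (inG_le u (h N))) // rX_le // leq_addl.
Qed.

Lemma inG_scale k f : inG 0 f -> inG k (gt ^+ k *: f).
Proof.
move=> [hA hf hd]; have e u : (gt ^+ k *: f) u = gt ^+ k * f u by [].
split=> [u|u|m]; rewrite ?e.
- by apply: (ur_M AU) => //; apply: ur_X; apply: (ur_gt AU).
- have := hf u; rewrite addn0 => hu.
  by rewrite (absM CC) (absX CC) addnC exprD ler_pM2l ?rX_gt0.
- have [M hM] := hd m; exists M => u /hM hu; rewrite e (absM CC) (absX CC).
  by rewrite (le_trans _ hu) // ler_piMl ?(abs_ge0 CC) // exprn_ile1 // ltW.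
Qed.

Lemma inG_divX k f : inG k f -> exists2 g, inG 0 g & f = gt ^+ k *: g.
Proof.
move=> [hA hf hd]; have gk : gt ^+ k != 0 by rewrite expf_neq0.
exists (fun u => f u / gt ^+ k); last first.
  by apply/funext => u; rewrite -[RHS]/(gt ^+ k * (f u / gt ^+ k)) mulrC divfK.
have e u m : abs (f u) <= r ^+ (nw u + m + k) -> abs (f u / gt ^+ k) <= r ^+ (nw u + m).
  by move=> h; rewrite (absM CC) (absV CC) (absX CC) ler_pdivrMr ?rX_gt0 // -exprD.
split=> [u|u|m].
- by apply: (ur_div AU) => //; rewrite (le_trans (hf u)) // rX_le // leq_addl.
- by apply: e; rewrite addn0.
- have [M hM] := hd (m + k)%N; exists M => u /hM; rewrite addnA; exact: e.
Qed.

Lemma C0P f : C0 abs n A gt f <-> inG 0 f.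
Proof.
have wtE (u : int * int) : (nw u)%:R = n%:R * wt n u :> rat.
  by rewrite -nwtE // -(nwE n_gt0).
have n0 : 0 < n%:R :> rat by rewrite ltr0n.
split=> [[xi [hA hd hf]]|[hA hf hd]].
  have hf' u : f u = xi u * gt ^+ nw u by rewrite hf -(nwE n_gt0).
  have hfm u m : abs (xi u) <= r ^+ m -> abs (f u) <= r ^+ (nw u + m).
    by move=> h; rewrite hf' (absM CC) (absX CC) mulrC exprD ler_pM2l ?rX_gt0.
  split=> [u|u|m].
  - by rewrite hf'; apply: (ur_M AU) => //; apply/ur_X/(ur_gt AU).
  - by apply: hfm; rewrite expr0 (ur_le1 AU).
  - have [M hM] := hd _ (rX_gt0 m); exists (n * Num.bound `|M|)%N => u hu.
    apply/hfm/ltW/hM; rewrite -(ler_pM2l n0) -wtE.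
    apply: le_trans (_ : (n * Num.bound `|M|)%:R <= _); last by rewrite ler_nat.
    rewrite natrM ler_pM2l // ltW // (le_lt_trans (ler_norm _)) //.
    exact: archi_boundP.
exists (fun u => f u / gt ^+ nw u); split=> [u|e e0|u].
- by apply: (ur_div AU) => //; have := hf u; rewrite addn0.
- have [m hm] := geom_small 1 r01 e0; have [M hM] := hd m.
  exists M%:R => u hu; have /hM : (M <= nw u)%N.
    rewrite -(ler_nat rat) wtE (le_trans hu) // ler_peMl ?ler1n //.
    by rewrite (le_trans _ hu) // ler0n.
  rewrite (absM CC) (absV CC) (absX CC) => h.
  rewrite ltr_pdivrMr ?rX_gt0 // (le_lt_trans h) // exprD mulrC ltr_pM2r ?rX_gt0 //.
  by have := hm m (leqnn m); rewrite mul1r.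
- by rewrite -(nwE n_gt0) -exprnP divfK // expf_neq0.
Qed.

(** The geometric bound only serves for convergence; the tail inherits the bound of its own terms,
    and with it the weight [nw u]. *)
Lemma tail_le (a : nat -> C) l b Y N :
  (forall K, abs (psum a K - l) <= b * r ^+ K) -> 0 < Y ->
  (forall i, (N <= i)%N -> abs (a i) <= Y) -> abs (l - psum a N) <= Y.
Proof.
move=> hl Y0 ha; have [K hK] := geom_small b r01 Y0.
have -> : l - psum a N = psum a (N + K) - psum a N - (psum a (N + K) - l) by ring.
apply: (abs_leB CC); last by rewrite ltW // (le_lt_trans (hl _)) // hK // leq_addl.
elim: (K) => [|k IH]; first by rewrite addn0 subrr (abs0 CC) ltW.
by rewrite addnS psumS addrAC (abs_leD CC) // ha // leq_addr.
Qed.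

Lemma inG_series (h : nat -> int * int -> C^o) : (forall i, inG i (h i)) ->
  exists H : int * int -> C^o,
    (forall u, cvg_abs abs (psum (fun i => h i u)) (H u)) /\
    forall N, inG N (H - \sum_(i < N) h i).
Proof.
move=> hG.
have /choice [H hH] : forall u, exists l, forall N,
    abs (psum (fun i => h i u) N - l) <= 1 * r ^+ N.
  move=> u; apply: (series_geom CC r01 ler01) => i; rewrite mul1r.
  by rewrite (le_trans (inG_le u (hG i))) // rX_le // leq_addl.
exists H; split=> [u|N]; first exact: (geom_cvg CC r01 (hH u)).
have sE u : (H - \sum_(i < N) h i) u = H u - psum (fun i => h i u) N.
  by rewrite /psum; rewrite [LHS]/=; congr (_ - _); rewrite fct_sumE.
have AH u : A (H u).
  apply: (ur_closed AU) => m; exists (psum (fun i => h i u) m).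
    by apply: ur_sum => i _; apply: inG_A (hG i).
  by rewrite (abs_distC CC) (le_trans (hH u m)) // mul1r.
split=> [u|u|m].
- by rewrite sE; apply: (ur_B AU) => //; apply: ur_sum => i _; apply: inG_A (hG i).
- rewrite sE; apply: (tail_le (hH u)); first exact: rX_gt0.
  by move=> i Ni; rewrite (le_trans (inG_le u (hG i))) // rX_le // leq_add2l.
(* Terms of index at least [m] already lie in gt^m C0, so only finitely many thresholds have to be
   combined. *)
- have /choice [M hM] : forall i, exists M, forall u, (M <= nw u)%N ->
      abs (h i u) <= r ^+ (nw u + m) by move=> i; case: (hG i) => _ _ /(_ m).
  exists (\max_(i < m) M i) => u hu; rewrite sE; apply: (tail_le (hH u)).
    exact: rX_gt0.
  move=> i _; have [im|mi] := ltnP i m.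
    by apply: hM; apply: leq_trans hu; apply: (leq_bigmax (Ordinal im)).
  by rewrite (le_trans (inG_le u (hG i))) // rX_le // leq_add2l.
Qed.

End Filtration.

(** * The operators Dx and Dy *)

Section Operators.
Variables (R : realType) (C : closedFieldType) (abs : C -> R) (p : nat).
Hypothesis CC : is_Cp abs p.
Variables (A : set C) (gt : C).
Hypothesis AU : is_unif_ring abs A gt.
Variable n : nat.
Hypothesis n_gt0 : (0 < n)%N.
Variables alpha tau : nat -> C.
Hypothesis A_alpha : forall i, A (alpha i).
Hypothesis alpha_le : forall i, abs (alpha i) <= abs gt ^+ (n * p ^ i + i).
Hypothesis A_tau : forall i, A (tau i).

Local Notation r := (abs gt).
Local Notation nw := (nw n).
Local Notation inG := (inG abs A gt n).
Local Notation laurent := (int * int -> C^o).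

(** The shift raises the weight by at most [d]; the factor [c] pays for this and leaves a gain of
    gt^i. *)
Lemma inG_shift k d i c v f : (forall u, nwt n u <= nwt n (u - v) + d%:Z) ->
  A c -> abs c <= r ^+ (d + i) -> inG k f ->
  inG (k + i) (fun u => c * f (u - v)).
Proof.
move=> hv Ac hc [hA hf hd].
have hv' u : (nw u <= nw (u - v)%R + d)%N.
  by rewrite -lez_nat PoszD !(nwE n_gt0).
have hm u m : abs (f (u - v)) <= r ^+ (nw (u - v)%R + m) ->
    abs (c * f (u - v)) <= r ^+ (nw u + (m + i)).
  move=> h; rewrite (absM CC).
  apply: le_trans (_ : r ^+ (d + i) * r ^+ (nw (u - v)%R + m) <= _).
    by rewrite ler_pM ?(abs_ge0 CC).
  rewrite -exprD (rX_le AU) //.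
  by move: (hv' u); move: (nw u) (nw (u - v)%R) => *; lia.
split=> [u|u|m]; first exact: (ur_M AU).
- exact: hm.
- have [M hM] := hd m; exists (M + d)%N => u hu.
  apply: le_trans (hm u m (hM _ _)) _; first by move: (hv' u) hu; move: (nw u) (nw (u - v)%R) => *; lia.
  by apply: (rX_le AU); lia.
Qed.

Section Direction.
Variables (pr : int * int -> int) (V : nat -> int * int) (kap : nat).
Hypothesis V_weight : forall u k, nwt n u <= nwt n (u - V k) + (n * k)%N%:Z.

(** Serves both operators: [Dx] is the case [fst], [vP n], [kap = n], and [Dy] the case [snd], [vQ],
    [kap = 1], with [alpha i] standing for [gammai i * p^i] and [tau i] for sigma^i(tb). *)
Definition sop (i : nat) (f : laurent) : laurent := fun u =>
  alpha i * (kap%:R * f (u - V (p ^ i)%N) - tau i * f (u - vS (p ^ i)%N)).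

Definition eop (f : laurent) : laurent := fun u => (pr u)%:~R * f u.

Definition top N (f : laurent) : laurent := eop f + \sum_(i < N) sop i f.

Definition dop (f : laurent) : laurent := fun u =>
  (pr u)%:~R * f u + infsum abs (fun i => sop i f u).

Lemma sop_lin i c f g : sop i (c *: f + g) = c *: sop i f + sop i g.
Proof.
apply/funext => u; rewrite /sop.
rewrite -[(c *: f + g) _]/(c * f _ + g _) -[(c *: f + g) _]/(c * f _ + g _).
rewrite -[RHS]/(c * _ + _); ring.
Qed.

Lemma eop_lin c f g : eop (c *: f + g) = c *: eop f + eop g.
Proof.
apply/funext => u; rewrite /eop.
rewrite -[(c *: f + g) _]/(c * f _ + g _) -[RHS]/(c * _ + _); ring.
Qed.

Lemma top_lin N c f g : top N (c *: f + g) = c *: top N f + top N g.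
Proof.
rewrite /top eop_lin; under eq_bigr do rewrite sop_lin.
by rewrite big_split -scaler_sumr scalerDr /= addrACA.
Qed.

Lemma sop_G k i f : inG k f -> inG (k + i) (sop i f).
Proof.
move=> hf.
have -> : sop i f = (fun u => alpha i * kap%:R * f (u - V (p ^ i)%N)) -
    (fun u => alpha i * tau i * f (u - vS (p ^ i)%N)).
  by apply/funext => u; rewrite /sop -[RHS]/(_ - _) mulrBr !mulrA.
have ha c : A c -> abs (alpha i * c) <= r ^+ (n * p ^ i + i).
  move=> Ac; rewrite (absM CC) (le_trans _ (alpha_le i)) //.
  by rewrite ler_piMr ?(abs_ge0 CC) // (ur_le1 AU).
apply: (inG_B CC AU).
  apply: (inG_shift (d := (n * p ^ i)%N)) => //; last by apply/ha/(ur_nat AU).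
  by apply: (ur_M AU) => //; apply: (ur_nat AU).
apply: (inG_shift (d := (n * p ^ i)%N)) => //; last exact: ha.
  by move=> u; apply: nwt_leS.
exact: (ur_M AU).
Qed.

Lemma eop_G k f : inG k f -> inG k (eop f).
Proof.
move=> [hA hf hd]; have hc u Y : abs (f u) <= Y -> abs (eop f u) <= Y.
  move=> fY; rewrite (absM CC) (le_trans _ fY) // ler_piMl ?(abs_ge0 CC) //.
  exact: (abs_int_le1 CC).
split=> [u|u|m]; [|exact: hc|].
  by apply: (ur_M AU) => //; apply: (ur_int AU).
by have [M hM] := hd m; exists M => u Mu; apply/hc/hM.
Qed.

Lemma top_G k N f : inG k f -> inG k (top N f).
Proof.
move=> hf; apply: (inG_D CC AU); first exact: eop_G.
apply: (inG_sum CC AU) => i _.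
by apply: inG_mono (sop_G i hf) => //; rewrite leq_addr.
Qed.

(** The omitted terms gain gt^N, so identities for [dop] follow from those of the finite operators
    [top N], which involve no limits. *)
Lemma dop_top N f : inG 0 f -> inG N (dop f - top N f).
Proof.
move=> hf; have [H [hH hN]] := inG_series CC AU (fun i => sop_G i hf).
suff -> : dop f - top N f = H - \sum_(i < N) sop i f by [].
have -> : dop f = eop f + H.
  by apply/funext => u; rewrite /dop (infsumE CC (hH u)).
by rewrite /top opprD addrACA subrr add0r.
Qed.

Lemma dop_G k f : inG k f -> inG k (dop f).
Proof.
move=> hf; rewrite -[dop f](subrK (top k f)).
apply: (inG_D CC AU); last exact: top_G.
by apply: dop_top; apply: inG_mono hf.
Qed.

Lemma dop_lin c f g : A c -> inG 0 f -> inG 0 g ->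
  dop (c *: f + g) = c *: dop f + dop g.
Proof.
move=> Ac hf hg; apply/eqP; rewrite -subr_eq0; apply/eqP.
apply: (inG_sep CC AU) => N.
have hfg : inG 0 (c *: f + g).
  by apply: (inG_D CC AU) => //; apply: (inG_Z CC AU).
have -> : dop (c *: f + g) - (c *: dop f + dop g) =
    (dop (c *: f + g) - top N (c *: f + g)) -
    (c *: (dop f - top N f) + (dop g - top N g)).
  by rewrite top_lin scalerBr; ring.
apply: (inG_B CC AU); first exact: dop_top.
by apply: (inG_D CC AU); [apply: (inG_Z CC AU) => //|]; apply: dop_top.
Qed.

Lemma dop0 : dop 0 = 0.
Proof.
have := dop_lin (ur_1 AU) (inG_0 CC AU n 0) (inG_0 CC AU n 0).
by rewrite !scale1r addr0 => e; apply: (addrI (dop 0)); rewrite addr0 -e.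
Qed.

Lemma dop_sum (I : Type) (s : seq I) (F : I -> laurent) (c : I -> C) :
  (forall i, A (c i)) -> (forall i, inG 0 (F i)) ->
  dop (\sum_(i <- s) c i *: F i) = \sum_(i <- s) c i *: dop (F i).
Proof.
move=> Ac hF; elim: s => [|i s IH]; first by rewrite !big_nil dop0.
rewrite !big_cons dop_lin ?IH //.
by apply: (inG_sum CC AU) => j _; apply: (inG_Z CC AU).
Qed.

Lemma dop_lead f u : inG 0 f -> abs (dop f u - ((pr u)%:~R * f u + sop 0 f u))
  <= r ^+ (nw u + 1).
Proof.
move=> hf; have [_ /(_ u) h _] := dop_top 1 hf.
by move: h; rewrite /top big_ord1.
Qed.

End Direction.

Lemma top_comm (pr1 pr2 : int * int -> int) (V1 V2 : nat -> int * int) k1 k2 N f :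
  (forall u v, pr1 (u - v) = pr1 u - pr1 v) ->
  (forall u v, pr2 (u - v) = pr2 u - pr2 v) ->
  (forall k, pr1 (V2 k) = 0) -> (forall k, pr2 (V1 k) = 0) ->
  (forall k, pr1 (vS k) = pr2 (vS k)) ->
  top pr1 V1 k1 N (top pr2 V2 k2 N f) = top pr2 V2 k2 N (top pr1 V1 k1 N f).
Proof.
move=> pr1B pr2B pr1V pr2V prS.
have eopD pr g h : eop pr (g + h) = eop pr g + eop pr h.
  by have := eop_lin pr 1 g h; rewrite !scale1r.
have sopD V k i g h : sop V k i (g + h) = sop V k i g + sop V k i h.
  by have := sop_lin V k i 1 g h; rewrite !scale1r.
have eop_sum pr (F : 'I_N -> laurent) :
    eop pr (\sum_i F i) = \sum_i eop pr (F i).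
  apply: (big_morph (eop pr)) => [g h|]; first exact: eopD.
  by apply/funext => u; rewrite /eop mulr0.
have sop_sum V k i (F : 'I_N -> laurent) :
    sop V k i (\sum_i F i) = \sum_j sop V k i (F j).
  apply: (big_morph (sop V k i)) => [g h|]; first exact: sopD.
  by apply/funext => u; rewrite /sop !mulr0 subrr mulr0.
have ee : eop pr1 (eop pr2 f) = eop pr2 (eop pr1 f).
  by apply/funext => u; rewrite /eop mulrCA.
(* The integrability condition E1(E2 H) = E2(E1 H), term by term; the two commutators of an Euler
   and a multiplication operator need not vanish, but they agree. *)
have es i : eop pr1 (sop V2 k2 i f) + sop V1 k1 i (eop pr2 f) =
    eop pr2 (sop V1 k1 i f) + sop V2 k2 i (eop pr1 f).
  apply/funext => u; rewrite -[LHS]/(_ + _) -[RHS]/(_ + _) /eop /sop.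
  rewrite !pr1B !pr2B pr1V pr2V prS !subr0 !rmorphB /=; ring.
have ss i j : sop V1 k1 i (sop V2 k2 j f) = sop V2 k2 j (sop V1 k1 i f).
  apply/funext => u; rewrite /sop.
  rewrite !(addrAC u (- V2 _)) !(addrAC u (- vS (p ^ j)%N)); ring.
rewrite /top !eopD !eop_sum ee -!addrA; congr (_ + _).
under [X in _ + X = _]eq_bigr do rewrite sopD sop_sum.
under [X in _ = _ + X]eq_bigr do rewrite sopD sop_sum.
rewrite !big_split /= !addrA; congr (_ + _).
  by rewrite -!big_split; apply: eq_bigr => i _; apply: es.
by rewrite exchange_big; apply: eq_bigr => i _; apply: eq_bigr => j _; apply: ss.
Qed.

Lemma dop_comm (pr1 pr2 : int * int -> int) (V1 V2 : nat -> int * int) k1 k2 f :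
  (forall u k, nwt n u <= nwt n (u - V1 k) + (n * k)%N%:Z) ->
  (forall u k, nwt n u <= nwt n (u - V2 k) + (n * k)%N%:Z) ->
  (forall u v, pr1 (u - v) = pr1 u - pr1 v) ->
  (forall u v, pr2 (u - v) = pr2 u - pr2 v) ->
  (forall k, pr1 (V2 k) = 0) -> (forall k, pr2 (V1 k) = 0) ->
  (forall k, pr1 (vS k) = pr2 (vS k)) -> inG 0 f ->
  dop pr1 V1 k1 (dop pr2 V2 k2 f) = dop pr2 V2 k2 (dop pr1 V1 k1 f).
Proof.
move=> hV1 hV2 pr1B pr2B pr1V pr2V prS hf.
have approx pr pr' V V' k k' N :
    (forall u k, nwt n u <= nwt n (u - V k) + (n * k)%N%:Z) ->
    (forall u k, nwt n u <= nwt n (u - V' k) + (n * k)%N%:Z) ->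
    inG N (dop pr V k (dop pr' V' k' f) - top pr V k N (top pr' V' k' N f)).
  move=> hV hV'; set g := dop pr' V' k' f.
  have hg : inG 0 g by apply: dop_G.
  have := top_lin pr V k N 1 (g - top pr' V' k' N f) (top pr' V' k' N f).
  rewrite scale1r subrK scale1r => gE.
  rewrite -[dop pr V k g](subrK (top pr V k N g)) -addrA.
  apply: (inG_D CC AU); first exact: dop_top.
  by rewrite gE addrK; apply: top_G => //; apply: dop_top.
apply/eqP; rewrite -subr_eq0; apply/eqP; apply: (inG_sep CC AU) => N.
set x := dop _ _ _ _; set y := dop _ _ _ _.
rewrite -[x](subrK (top pr1 V1 k1 N (top pr2 V2 k2 N f))).
rewrite -addrA -[_ - y]opprB; apply: (inG_B CC AU); first exact: approx.
by rewrite top_comm //; apply: approx.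
Qed.

End Operators.

(** * An orthonormal basis of C0 adapted to Dx and Dy *)

Section Basis.
Variables (R : realType) (C : closedFieldType) (abs : C -> R) (p : nat).
Hypothesis CC : is_Cp abs p.
Variables (A : set C) (gt : C).
Hypothesis AU : is_unif_ring abs A gt.
Variable n : nat.
Hypothesis n_gt0 : (0 < n)%N.
Variables alpha tau : nat -> C.
Hypothesis A_alpha : forall i, A (alpha i).
Hypothesis alpha_le : forall i, abs (alpha i) <= abs gt ^+ (n * p ^ i + i).
Hypothesis A_tau : forall i, A (tau i).
Hypothesis abs_alpha0 : abs (alpha 0%N) = abs gt ^+ n.
Hypothesis abs_tau0 : abs (tau 0%N) = 1.
Hypothesis abs_n : abs n%:R = 1.

Local Notation r := (abs gt).
Local Notation nw := (nw n).
Local Notation inG := (inG abs A gt n).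
Local Notation laurent := (int * int -> C^o).
Local Notation D1 := (dop abs p alpha tau fst (vP n) n).
Local Notation D2 := (dop abs p alpha tau snd vQ 1).

Let rgt0 : 0 < r. Proof. by case/andP: (ur_itv AU). Qed.
Let rlt1 : r < 1. Proof. by case/andP: (ur_itv AU). Qed.
Let r01 : 0 <= r < 1. Proof. by rewrite rlt1 ltW. Qed.
Let gt0 : gt != 0.
Proof. by apply/eqP => g0; have := rgt0; rewrite g0 (abs0 CC) ltxx. Qed.
Let rX_lt i j : (i < j)%N -> r ^+ j < r ^+ i.
Proof. by move=> ij; rewrite ltr_iXn2l. Qed.

(** * Leading exponents modulo [gt] *)

Definition light (f : laurent) u := abs (f u) < r ^+ nw u.

(** Modulo [gt], [f] is a unit times the normalised monomial of exponent [w] plus monomials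
    preceding it; light coefficients are those that vanish modulo [gt]. *)
Definition leads (f : laurent) w := [/\ inG 0 f, abs (f w) = r ^+ nw w &
  forall u, u <> w -> ~ light f u -> below n u w].

Lemma shift_light f c v u : inG 0 f -> abs c = r ^+ n ->
  nwt n u <= nwt n (u - v) + n%:Z -> ~ (abs (c * f (u - v)) < r ^+ nw u) ->
  ~ light f (u - v) /\ nwt n u = nwt n (u - v) + n%:Z.
Proof.
move=> hf hc huv.
have huv' : (nw u <= nw (u - v)%R + n)%N.
  by rewrite -lez_nat PoszD !(nwE n_gt0).
rewrite (absM CC) hc => nl; split.
  move=> l; apply: nl; apply: lt_le_trans (_ : r ^+ n * r ^+ nw (u - v)%R <= _).
    by rewrite ltr_pM2l ?exprn_gt0.
  by rewrite -exprD addnC (rX_le AU).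
apply/eqP; rewrite eq_le huv /= -!(nwE n_gt0) -PoszD lez_nat leqNgt; apply/negP.
move=> lt; apply: nl; apply: le_lt_trans (rX_lt lt).
rewrite addnC exprD ler_pM2l ?exprn_gt0 //.
by have := inG_le (u - v) hf; rewrite addn0.
Qed.

(** [v1] is the shift that wins at [w], [v2] its rival, and [z] the eigenvalue of the Euler
    operator, whose non-light exponents are at most [w] and hence below [s w]. *)
Lemma leads_step f g w (c1 c2 : C) (v1 v2 : int * int) (z : int * int -> C)
    (s : int * int -> int * int) :
  leads f w -> inG 0 g ->
  (forall u, abs (g u - (z u * f u + (c1 * f (u - v1) + c2 * f (u - v2))))
     < r ^+ nw u) ->
  (forall u, abs (z u) <= 1) -> abs c1 = r ^+ n -> abs c2 = r ^+ n ->
  v1 <> v2 ->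
  (forall u, nwt n u <= nwt n (u - v1) + n%:Z) ->
  (forall u, nwt n u <= nwt n (u - v2) + n%:Z) ->
  (forall u, nwt n (s u) = nwt n u + n%:Z) ->
  (forall u v, below n u v -> below n (s u) (s v)) ->
  (forall u v, v = u + v1 \/ v = u + v2 -> nwt n v = nwt n u + n%:Z ->
     v = s u \/ below n v (s u)) ->
  s w = w + v1 ->
  leads g (s w).
Proof.
move=> [hf fw fl] hg hgf hz hc1 hc2 v12 hv1 hv2 ns bs ls sw.
have below_s u : below n u (s u).
  by apply: (below_nwt n_gt0); rewrite ns ltrDl ltz_nat.
have fl' u : ~ light f u -> u = w \/ below n u w.
  by move=> nl; have [->|/eqP uw] := eqVneq u w; [left | right; apply: fl].
have case_shift v u : v = v1 \/ v = v2 -> ~ light f (u - v) ->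
    nwt n u = nwt n (u - v) + n%:Z -> u = s w /\ u - v = w \/ below n u (s w).
  move=> hv nl nu; have h : u = s (u - v) \/ below n u (s (u - v)).
    by apply: ls => //; case: hv => ->; rewrite subrK; [left | right].
  case: (fl' _ nl) h => [->|b] [h|h]; [by left | by right | right | right].
    by rewrite h; apply: bs.
  by apply: (below_trans n_gt0) h _; apply: bs.
have zf u : abs (z u * f u) <= abs (f u).
  by rewrite (absM CC) ler_piMl // (abs_ge0 CC).
have main u : ~ light g u -> u <> s w -> below n u (s w).
  move=> nl usw.
  have [l0|nl0] := pselect (light f u); last first.
    by case: (fl' _ nl0) => [->|b] //; apply: (below_trans n_gt0) b (below_s _).
  have [l1|nl1] := pselect (abs (c1 * f (u - v1)) < r ^+ nw u); last first.
    have [a b] := shift_light hf hc1 (hv1 u) nl1.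
    by have [[]|//] := case_shift v1 u (or_introl erefl) a b.
  have [l2|nl2] := pselect (abs (c2 * f (u - v2)) < r ^+ nw u); last first.
    have [a b] := shift_light hf hc2 (hv2 u) nl2.
    by have [[]|//] := case_shift v2 u (or_intror erefl) a b.
  exfalso; apply: nl; rewrite /light.
  rewrite -[g u](subrK (z u * f u + (c1 * f (u - v1) + c2 * f (u - v2)))).
  apply: (abs_ltD CC) => //; apply: (abs_ltD CC); last exact: (abs_ltD CC).
  exact: le_lt_trans (zf u) l0.
split=> //; last by move=> u usw nl; apply: main.
have irr u : below n u u -> False by rewrite below_irr.
(* All terms but [c1 * f w] are light at [s w]: a rival contribution through [v2] would have to come
   from [w] itself and force [v1 = v2]. *)
have -> : g (s w) = c1 * f w + (g (s w) - (z (s w) * f (s w) +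
    (c1 * f (s w - v1) + c2 * f (s w - v2))) + z (s w) * f (s w)
    + c2 * f (s w - v2)).
  by rewrite {5}sw addrK; ring.
have c1w : abs (c1 * f w) = r ^+ nw (s w).
  rewrite (absM CC) hc1 fw -exprD addnC; congr (_ ^+ _).
  by apply/eqP; rewrite -eqz_nat PoszD !(nwE n_gt0) ns.
rewrite (abs_domD CC) // c1w; apply: (abs_ltD CC); first apply: (abs_ltD CC) => //.
- have [l|nl] := pselect (light f (s w)); first exact: le_lt_trans (zf _) l.
  case: (fl' _ nl) => [e|b]; first by case: (irr w); rewrite -{2}e.
  by case: (irr w); apply: (below_trans n_gt0) b.
- have [//|nl] := pselect (abs (c2 * f (s w - v2)) < r ^+ nw (s w)).
  have [a b] := shift_light hf hc2 (hv2 _) nl.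
  have [[_ e]|] := case_shift v2 (s w) (or_intror erefl) a b; last by move/irr.
  case: v12; move: e; rewrite sw -[RHS]addr0 -addrA => /addrI/eqP.
  by rewrite subr_eq0 => /eqP.
Qed.

Lemma vP_weight u k : nwt n u <= nwt n (u - vP n k) + (n * k)%N%:Z.
Proof. exact: nwt_leP. Qed.

Lemma vQ_weight u k : nwt n u <= nwt n (u - vQ k) + (n * k)%N%:Z.
Proof. exact: nwt_leQ. Qed.

Lemma D1_G k f : inG k f -> inG k (D1 f).
Proof. exact: (dop_G CC AU n_gt0 A_alpha alpha_le A_tau fst n vP_weight). Qed.

Lemma D2_G k f : inG k f -> inG k (D2 f).
Proof. exact: (dop_G CC AU n_gt0 A_alpha alpha_le A_tau snd 1 vQ_weight). Qed.

Lemma D1_lin c f g : A c -> inG 0 f -> inG 0 g -> D1 (c *: f + g) = c *: D1 f + D1 g.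
Proof. exact: (dop_lin CC AU n_gt0 A_alpha alpha_le A_tau fst n vP_weight). Qed.

Lemma D2_lin c f g : A c -> inG 0 f -> inG 0 g -> D2 (c *: f + g) = c *: D2 f + D2 g.
Proof. exact: (dop_lin CC AU n_gt0 A_alpha alpha_le A_tau snd 1 vQ_weight). Qed.

Lemma D12_comm f : inG 0 f -> D2 (D1 f) = D1 (D2 f).
Proof.
move=> hf; apply: (dop_comm CC AU n_gt0 A_alpha alpha_le A_tau) => //.
- exact: vQ_weight.
- exact: vP_weight.
Qed.

Lemma leads_D1 f w : leads f w -> leads (D1 f) (sx n w).
Proof.
move=> hl; have [hf _ _] := hl.
pose cP := alpha 0%N * n%:R; pose cS := - (alpha 0%N * tau 0%N).
have hcP : abs cP = r ^+ n by rewrite (absM CC) abs_n mulr1.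
have hcS : abs cS = r ^+ n by rewrite (absN CC) (absM CC) abs_tau0 mulr1.
pose z (u : int * int) : C := u.1%:~R.
have hz u : abs (z u) <= 1 by apply: (abs_int_le1 CC).
have hP u : nwt n u <= nwt n (u - vP n 1) + n%:Z.
  by have := vP_weight u 1; rewrite muln1.
have hS u : nwt n u <= nwt n (u - vS 1) + n%:Z.
  by have := nwt_leS n_gt0 u 1; rewrite muln1.
have ns u : nwt n (sx n u) = nwt n u + n%:Z by case: (sx_facts n_gt0 u).
have lead u : abs (D1 f u - (z u * f u + (cP * f (u - vP n 1) + cS * f (u - vS 1))))
    < r ^+ nw u.
  apply: le_lt_trans (_ : _ <= r ^+ (nw u + 1)) _; last by rewrite rX_lt // addn1.
  have := dop_lead CC AU n_gt0 A_alpha alpha_le A_tau fst n vP_weight u hf.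
  by rewrite /sop expn0 mulrBr !mulrA -mulNr.
have PS : vP n 1 <> vS 1 by [].
(* The winning shift depends on the cone of [w], so the two shifts exchange roles in cone 2. *)
have [cw|cw] := eqVneq (cone w) 2.
  apply: (leads_step (s := sx n) (v1 := vS 1) (v2 := vP n 1) (z := z)
    (c1 := cS) (c2 := cP) hl) => //.
  - exact: D1_G.
  - by move=> u; have := lead u; rewrite [X in z u * f u + X]addrC.
  - by move=> u v; apply: below_sx.
  - by move=> u v h; apply: sx_lead => //; tauto.
  - by rewrite /sx cw.
apply: (leads_step (s := sx n) (v1 := vP n 1) (v2 := vS 1) (z := z)
  (c1 := cP) (c2 := cS) hl) => //.
- exact: D1_G.
- by move=> u v; apply: below_sx.
- by move=> u v h; apply: sx_lead.
- by rewrite /sx (negbTE cw).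
Qed.

Lemma leads_D2 f w : leads f w -> leads (D2 f) (sy w).
Proof.
move=> hl; have [hf _ _] := hl.
pose cQ := alpha 0%N * 1%:R; pose cS := - (alpha 0%N * tau 0%N).
have hcQ : abs cQ = r ^+ n by rewrite /cQ mulr1.
have hcS : abs cS = r ^+ n by rewrite (absN CC) (absM CC) abs_tau0 mulr1.
pose z (u : int * int) : C := u.2%:~R.
have hz u : abs (z u) <= 1 by apply: (abs_int_le1 CC).
have hQ u : nwt n u <= nwt n (u - vQ 1) + n%:Z.
  by have := vQ_weight u 1; rewrite muln1.
have hS u : nwt n u <= nwt n (u - vS 1) + n%:Z.
  by have := nwt_leS n_gt0 u 1; rewrite muln1.
have ns u : nwt n (sy u) = nwt n u + n%:Z by case: (sy_facts n_gt0 u).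
have lead u : abs (D2 f u - (z u * f u + (cQ * f (u - vQ 1) + cS * f (u - vS 1))))
    < r ^+ nw u.
  apply: le_lt_trans (_ : _ <= r ^+ (nw u + 1)) _; last by rewrite rX_lt // addn1.
  have := dop_lead CC AU n_gt0 A_alpha alpha_le A_tau snd 1 vQ_weight u hf.
  by rewrite /sop expn0 mulrBr !mulrA -mulNr.
have QS : vQ 1 <> vS 1 by [].
have [cw|cw] := eqVneq (cone w) 1.
  apply: (leads_step (s := sy) (v1 := vS 1) (v2 := vQ 1) (z := z)
    (c1 := cS) (c2 := cQ) hl) => //.
  - exact: D2_G.
  - by move=> u; have := lead u; rewrite [X in z u * f u + X]addrC.
  - by move=> u v; apply: below_sy.
  - by move=> u v h; apply: sy_lead => //; tauto.
  - by rewrite /sy cw.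
apply: (leads_step (s := sy) (v1 := vQ 1) (v2 := vS 1) (z := z)
  (c1 := cQ) (c2 := cS) hl) => //.
- exact: D2_G.
- by move=> u v; apply: below_sy.
- by move=> u v h; apply: sy_lead.
- by rewrite /sy (negbTE cw).
Qed.

(** * The family of iterated images of the monomials eps_i *)

Definition wmonom (u : int * int) : laurent := fun v => gt ^+ nw u * (v == u)%:R.
Local Notation X := wmonom.

Lemma leads_X u : leads (X u) u.
Proof.
have XuE : X u u = gt ^+ nw u by rewrite /X eqxx mulr1.
have X0 v : v <> u -> X u v = 0 by move=> /eqP/negbTE vu; rewrite /X vu mulr0.
split; last 2 first.
- by rewrite XuE (absX CC).
- by move=> v /X0 e []; rewrite /light e (abs0 CC) exprn_gt0.
split=> [v|v|m].
- by apply: (ur_M AU); [apply/(ur_X AU)/(ur_gt AU) | apply: (ur_nat AU)].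
- have [->|/eqP/X0 ->] := eqVneq v u; first by rewrite XuE (absX CC) addn0.
  by rewrite (abs0 CC) ltW // exprn_gt0.
- exists (nw u).+1 => v; have [->|/eqP/X0 -> _] := eqVneq v u; first by rewrite ltnn.
  by rewrite (abs0 CC) ltW // exprn_gt0.
Qed.

Definition Dmonom (j : nat * nat * nat) : laurent :=
  let: (i, a, b) := j in iter a D1 (iter b D2 (X (pt n (i, 0%N, 0%N)))).
Local Notation B := Dmonom.

Lemma leads_B j : leads (B j) (pt n j).
Proof.
case: j => [[i a] b]; rewrite /B; elim: a => [|a IH] /=.
  elim: b => [|b IH] /=; first exact: leads_X.
  by move: (leads_D2 IH); rewrite -(pt_sy n_gt0).
by move: (leads_D1 IH); rewrite -(pt_sx n_gt0).
Qed.

Lemma B_G j : inG 0 (B j). Proof. by case: (leads_B j). Qed.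

Lemma D1_B i a b : D1 (B (i, a, b)) = B (i, a.+1, b).
Proof. by []. Qed.

(** Commutation moves [D2] past the [a] outer factors [D1]. *)
Lemma D2_B i a b : D2 (B (i, a, b)) = B (i, a, b.+1).
Proof.
elim: a => // a IH; rewrite -[B (i, a.+1, b.+1)]/(D1 (B (i, a, b.+1))) -IH.
by rewrite -[B (i, a.+1, b)]/(D1 (B (i, a, b))) D12_comm //; apply: B_G.
Qed.

Local Notation idx := (nat * nat * nat)%type.

Definition valid (j : idx) := (j.1.1 <= 2 * n)%N.

(** * Spanning and independence modulo powers of [gt] *)

Definition fin_span (P : pred idx) (f : laurent) := exists s (c : idx -> C),
  [/\ uniq s, {in s, forall j, valid j && P j}, forall j, A (c j) &
      f = \sum_(j <- s) c j *: B j].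

Lemma sum_widen (s s' : seq idx) (c : idx -> C) : uniq s -> uniq s' ->
  {subset s <= s'} -> \sum_(j <- s) c j *: B j =
    \sum_(j <- s') (if j \in s then c j else 0) *: B j.
Proof.
move=> us us' ss'; rewrite [RHS](bigID (mem s)) /= [X in _ + X]big1; last first.
  by move=> j /negbTE ->; rewrite scale0r.
rewrite addr0; under [RHS]eq_bigr => j /= -> do [].
rewrite -[RHS]big_filter; apply: perm_big; apply: uniq_perm => //; first exact: filter_uniq.
move=> j; rewrite mem_filter /=; case js: (j \in s) => //=.
by rewrite ss'.
Qed.

Lemma fin_lin P c f g : A c -> fin_span P f -> fin_span P g -> fin_span P (c *: f + g).
Proof.
move=> Ac [s1 [c1 [u1 v1 A1 ->]]] [s2 [c2 [u2 v2 A2 ->]]].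
exists (undup (s1 ++ s2)), (fun j => c * (if j \in s1 then c1 j else 0) +
  (if j \in s2 then c2 j else 0)); split.
- exact: undup_uniq.
- by move=> j; rewrite mem_undup mem_cat => /orP[/v1|/v2].
- by move=> j; apply: (ur_D AU); [apply: (ur_M AU) => // |]; case: ifP => // _;
    apply: (ur_0 AU).
- rewrite (@sum_widen s1 (undup (s1 ++ s2))) ?undup_uniq //; last first.
    by move=> j js; rewrite mem_undup mem_cat js.
  rewrite (@sum_widen s2 (undup (s1 ++ s2))) ?undup_uniq //; last first.
    by move=> j js; rewrite mem_undup mem_cat js orbT.
  rewrite scaler_sumr -big_split; apply: eq_bigr => j _ /=.
  by rewrite scalerA scalerDl.
Qed.

Lemma fin0 P : fin_span P 0.
Proof.
by exists [::], (fun=> 0); split=> // [j|]; [exact: (ur_0 AU) | rewrite big_nil].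
Qed.

Lemma finB (P : pred idx) j : valid j -> P j -> fin_span P (B j).
Proof.
move=> vj Pj; exists [:: j], (fun=> 1); split=> // [k|k|].
- by rewrite inE => /eqP ->; rewrite vj.
- exact: (ur_1 AU).
- by rewrite big_seq1 scale1r.
Qed.

Lemma fin_G P f : fin_span P f -> inG 0 f.
Proof.
move=> [s [c [_ _ Ac ->]]]; apply: (inG_sum CC AU) => j _.
by apply: (inG_Z CC AU) => //; apply: B_G.
Qed.

Lemma fin_sum P (I : eqType) (s : seq I) (c : I -> C) (F : I -> laurent) :
  (forall i, A (c i)) -> (forall i, i \in s -> fin_span P (F i)) ->
  fin_span P (\sum_(i <- s) c i *: F i).
Proof.
move=> Ac; elim: s => [|i s IH] hF; first by rewrite big_nil; apply: fin0.
rewrite big_cons; apply: fin_lin => //; first by apply: hF; rewrite mem_head.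
by apply: IH => j js; apply: hF; rewrite in_cons js orbT.
Qed.

(** Discreteness of the valuation on [A] turns pointwise strict inequalities into a uniform gain of
    one power of [gt]. *)
Lemma inG1_light f : inG 0 f -> (forall u, light f u) -> inG 1 f.
Proof.
move=> [hA hf hd] hl; split=> // u.
have Au : A (f u / gt ^+ nw u).
  by apply: (ur_div AU) => //; have := hf u; rewrite addn0.
have := ur_lt1 AU Au; rewrite (absM CC) (absV CC) (absX CC).
rewrite ltr_pdivrMr ?exprn_gt0 // mul1r ler_pdivrMr ?exprn_gt0 // -exprS addn1.
by move=> h; apply: h; apply: hl.
Qed.

Lemma decomp f : inG 0 f -> exists s, [/\ uniq s,
  forall v, v \in s -> ~ light f v &
  inG 1 (f - \sum_(v <- s) (f v / gt ^+ nw v) *: X v)].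
Proof.
move=> hf; have [hA hle hd] := hf; have [M hM] := hd 1%N.
(* A finite box containing every exponent of weight below [M], because the weight i + n (a + b)
   bounds [a] and [b]. *)
pose box := [seq pt n (x, b) |
  x <- [seq (i, a) | i <- iota 0 (2 * n).+1, a <- iota 0 M], b <- iota 0 M].
have boxP v : (nw v < M)%N -> v \in box.
  have [i [a [b [hi ->]]]] := pt_surj n_gt0 v; rewrite nw_pt // => hM'.
  apply/allpairsPdep; exists (i, a), b; split=> //; last by rewrite mem_iota; nia.
  by apply/allpairsPdep; exists i, a; split=> //; rewrite mem_iota; nia.
exists [seq v <- undup box | ~~ (abs (f v) < r ^+ nw v)].
have us : uniq [seq v <- undup box | ~~ (abs (f v) < r ^+ nw v)].
  by rewrite filter_uniq // undup_uniq.
split=> //; first by move=> v; rewrite mem_filter => /andP[/negP].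
have Xval (v u : int * int) : X v u = gt ^+ nw v * (u == v)%:R by [].
apply: inG1_light.
  apply: (inG_B CC AU) => //; apply: (inG_sum CC AU) => v _.
  apply: (inG_Z CC AU); last by case: (leads_X v).
  by apply: (ur_div AU) => //; have := hle v; rewrite addn0.
move=> u; rewrite /light; set s := [seq _ <- _ | _] in us *.
have -> : (f - \sum_(v <- s) (f v / gt ^+ nw v) *: X v) u =
    f u - \sum_(v <- s) (f v / gt ^+ nw v) * X v u.
  by rewrite -[LHS]/(_ - _) fct_sumE.
have [su|su] := boolP (u \in s).
  rewrite (bigD1_seq u) //= big1 => [|v /negbTE vu].
    by rewrite Xval eqxx mulr1 addr0 divfK ?expf_neq0 // subrr (abs0 CC) exprn_gt0.
  by rewrite Xval eq_sym vu !mulr0.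
rewrite big_seq big1 => [|v vs]; last first.
  by rewrite Xval (_ : (u == v) = false) ?mulr0 //; apply: contraNF su => /eqP ->.
rewrite subr0; have [uM|Mu] := ltnP (nw u) M; last first.
  by apply: le_lt_trans (hM _ Mu) _; rewrite rX_lt // addn1.
by move: su; rewrite mem_filter mem_undup boxP // andbT negbK.
Qed.

(** Triangularity: modulo [gt], the member with leading exponent [u] is a unit times [X u] plus
    monomials of smaller rank, to which induction applies. *)
Lemma spanned_X u : exists2 f, fin_span predT f & inG 1 (X u - f).
Proof.
have [k] := ubnP (rank n u); elim: k u => // k IH u.
rewrite ltnS => uk; have [i [a [b [vi uE]]]] := pt_surj n_gt0 u.
have [hB Bu Bl] := leads_B (i, a, b); rewrite -uE in Bu Bl.
have [s [us sl hs]] := decomp hB; set f := B (i, a, b) in Bu Bl hs sl hB.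
pose c v := f v / gt ^+ nw v.
have Ac v : A (c v).
  by apply: (ur_div AU); [apply: inG_A hB | have := inG_le v hB; rewrite addn0].
have cu : abs (c u) = 1.
  by rewrite (absM CC) (absV CC) (absX CC) Bu divff // gt_eqF // exprn_gt0.
have cu0 : c u != 0.
  by apply/eqP => e; move: cu; rewrite e (abs0 CC) => /eqP; rewrite eq_sym oner_eq0.
have su : u \in s.
  have [//|nsu] := boolP (u \in s); have := inG_le u hs.
  rewrite -[(_ - _) u]/(_ - _) fct_sumE big_seq big1 => [|v vs].
    by rewrite subr0 Bu leNgt rX_lt // addn1.
  rewrite -[(_ *: _) _]/(_ * (_ * _)) (_ : (u == v) = false) ?mulr0 //.
  by apply: contraNF nsu => /eqP ->.
have /choice [g hg] : forall v, exists g, v \in s -> v != u ->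
    fin_span predT g /\ inG 1 (X v - g).
  move=> v; have [vs|_] := boolP (v \in s); last by exists 0.
  have [->|vu] := eqVneq v u; first by exists 0.
  have : below n v u by apply: Bl; [exact/eqP | exact: sl].
  move/(below_rank n_gt0) => lt; have [|g ? ?] := IH v; first by lia.
  by exists g.
have ACV : A (c u)^-1 by apply: (ur_V AU).
pose rest := \sum_(v <- [seq v <- s | v != u]) c v *: g v.
have frest : fin_span predT rest.
  by apply: fin_sum => // v; rewrite mem_filter => /andP[vu vs]; case: (hg v vs vu).
exists ((c u)^-1 *: (f - rest)).
  rewrite -[_ *: _]addr0; apply: fin_lin => //; last exact: fin0.
  have -> : f - rest = -1 *: rest + f by rewrite scaleN1r addrC.
  apply: fin_lin => //; first by apply/(ur_N AU)/(ur_1 AU).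
  by apply: finB.
have -> : X u - (c u)^-1 *: (f - rest) =
    - (c u)^-1 *: ((f - \sum_(v <- s) c v *: X v)
      + \sum_(v <- [seq v <- s | v != u]) c v *: (X v - g v)).
  rewrite (bigD1_seq u) //= -big_filter.
  under [X in - _ *: (_ + X)]eq_bigr do rewrite scalerBr.
  rewrite sumrB -/rest; set S := \sum_(v <- _) c v *: X v.
  have -> : f - (c u *: X u + S) + (S - rest) = - (c u *: X u - (f - rest)) by ring.
  by rewrite scaleNr scalerN opprK [RHS]scalerBr scalerA mulVf // scale1r.
apply: (inG_Z CC AU); first exact: (ur_N AU).
apply: (inG_D CC AU) => //; rewrite big_seq; apply: (inG_sum CC AU) => v.
rewrite mem_filter => /andP[vu vs]; apply: (inG_Z CC AU) => //.
by case: (hg v vs vu).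
Qed.

(** Each round divides the error by gt^m and approximates the quotient modulo [gt]. *)
Lemma spanned m f : inG 0 f -> exists2 g, fin_span predT g & inG m (f - g).
Proof.
elim: m => [|m IH] hf; first by exists 0; [exact: fin0 | rewrite subr0].
have [g hg] := IH hf; move=> /(inG_divX CC AU)[k hk kE].
have [s [us sl hs]] := decomp hk.
have /choice [h hh] : forall v, exists h, fin_span predT h /\ inG 1 (X v - h).
  by move=> v; have [h ? ?] := spanned_X v; exists h.
pose c v := k v / gt ^+ nw v.
have Ac v : A (c v).
  by apply: (ur_div AU); [apply: inG_A hk | have := inG_le v hk; rewrite addn0].
pose k1 := \sum_(v <- s) c v *: h v.
have hk1 : inG 1 (k - k1).
  have -> : k - k1 = (k - \sum_(v <- s) c v *: X v) + \sum_(v <- s) c v *: (X v - h v).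
    by under [X in _ = _ + X]eq_bigr do rewrite scalerBr; rewrite sumrB subrKA.
  apply: (inG_D CC AU) => //; apply: (inG_sum CC AU) => v _.
  by apply: (inG_Z CC AU) => //; case: (hh v).
exists (gt ^+ m *: k1 + g).
  apply: fin_lin => //; first by apply/(ur_X AU)/(ur_gt AU).
  by apply: fin_sum => // v _; case: (hh v).
rewrite opprD addrCA [_ + (f - g)]addrC kE -scalerBr.
move: hk1 => /(inG_divX CC AU)[k2 hk2 ->].
by rewrite scalerA -exprSr; apply: (inG_scale CC AU).
Qed.

(** Evaluate the sum at the leading exponent of [B j], highest rank first: members of larger rank
    have small coefficients by induction, and the remaining ones are light there. *)
Lemma indep1 s (c : idx -> C) : uniq s -> {in s, forall j, valid j} ->
  (forall j, A (c j)) -> inG 1 (\sum_(j <- s) c j *: B j) ->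
  {in s, forall j, abs (c j) < 1}.
Proof.
move=> us vs Ac hG.
(* A bound for all ranks in the list, which makes [S - rank] a measure for descending induction. *)
pose S := (\sum_(i <- s) rank n (pt n i))%N.
suff main : forall k j, j \in s -> (S - rank n (pt n j) < k)%N ->
    abs (c j) < 1.
  by move=> j js; apply: main (ltnSn _).
elim=> // k IH j js; rewrite ltnS => hk.
have rank_le i : i \in s -> (rank n (pt n i) <= S)%N.
  by move=> si; rewrite /S (bigD1_seq i) //= leq_addr.
have [//|c1] := ltP (abs (c j)) 1.
have {c1} c1 : abs (c j) = 1 by apply/eqP; rewrite eq_le (ur_le1 AU).
set u := pt n j.
have := inG_le u hG; rewrite fct_sumE (bigD1_seq j) //=.
have eB : abs ((c j *: B j) u) = r ^+ nw u.
  by rewrite -[_ u]/(c j * B j u) (absM CC) c1 mul1r; case: (leads_B j).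
rewrite (abs_domD CC) ?eB; first by rewrite leNgt rX_lt // addn1.
apply: (abs_lt_sum CC) => [|i si ij]; first exact: exprn_gt0.
rewrite -[_ u]/(c i * B i u) (absM CC); have [Bi _ Bl] := leads_B i.
have [l|nl] := pselect (light (B i) u).
  by apply: le_lt_trans l; rewrite ler_piMl ?(abs_ge0 CC) // (ur_le1 AU).
have ui : u <> pt n i.
  move: ij (vs _ si) (vs _ js); rewrite /u.
  case: i {si Bi Bl nl} => [[i a] b]; case: j {js hk c1 u eB} => [[i' a'] b'] ij vi vj.
  by move=> /esym/(pt_inj n_gt0 vi vj) e; rewrite e eqxx in ij.
have /(below_rank n_gt0) lt := Bl _ ui nl.
have ci : abs (c i) < 1.
  apply: IH => //; move: (rank_le _ si) hk lt; rewrite -/u.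
  by move: (rank n u) (rank n (pt n i)) => *; lia.
have := inG_le u Bi; rewrite addn0 => h.
rewrite (le_lt_trans (_ : _ <= abs (c i) * r ^+ nw u)) //.
  by rewrite ler_wpM2l ?(abs_ge0 CC).
by rewrite -[ltRHS]mul1r ltr_pM2r // exprn_gt0.
Qed.

Lemma indep m s (c : idx -> C) : uniq s -> {in s, forall j, valid j} ->
  (forall j, A (c j)) -> inG m (\sum_(j <- s) c j *: B j) ->
  {in s, forall j, abs (c j) <= r ^+ m}.
Proof.
move=> us vs; elim: m c => [|m IH] c Ac hG j js; first by rewrite expr0 (ur_le1 AU).
have c1 i : i \in s -> abs (c i) <= r.
  move=> si; apply: (ur_lt1 AU) => //; apply: indep1 (si) => //.
  by apply: inG_mono hG.
pose c' i := if i \in s then c i / gt else 0.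
have cE i : i \in s -> c i = gt * c' i by move=> si; rewrite /c' si mulrC divfK.
have Ac' i : A (c' i).
  rewrite /c'; case: ifP => [si|_]; last exact: (ur_0 AU).
  by rewrite -[gt]expr1; apply: (ur_div AU) => //; rewrite expr1 c1.
have sE : \sum_(i <- s) c i *: B i = gt *: \sum_(i <- s) c' i *: B i.
  by rewrite scaler_sumr; apply: eq_big_seq => i si; rewrite cE // scalerA.
have hG' : inG m (\sum_(i <- s) c' i *: B i).
  have [g hg] := inG_divX CC AU hG; rewrite sE exprS -scalerA => e.
  have -> : \sum_(i <- s) c' i *: B i = gt ^+ m *: g.
    by rewrite -[LHS]scale1r -(mulVf gt0) -scalerA e scalerA mulVf // scale1r.
  exact: (inG_scale CC AU).
by rewrite cE // (absM CC) exprS ler_pM2l // IH.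
Qed.

(** * The quotient by the images of the operators *)

Definition weps (i : nat) : laurent := X (pt n (i, 0%N, 0%N)).
Local Notation E := weps.

Lemma E_G i : inG 0 (E i). Proof. by case: (leads_X (pt n (i, 0%N, 0%N))). Qed.

Definition reduces (f : laurent) (c : nat -> C) (g h : laurent) :=
  [/\ forall i, A (c i), inG 0 g, inG 0 h &
      f = \sum_(i < (2 * n).+1) c i *: E i + D1 g + D2 h].

Definition reducible f := exists c g h, reduces f c g h.

Lemma reducible_lin a f f' : A a -> reducible f -> reducible f' ->
  reducible (a *: f + f').
Proof.
move=> Aa [c [g [h [Ac hg hh ->]]]] [c' [g' [h' [Ac' hg' hh' ->]]]].
exists (fun i => a * c i + c' i), (a *: g + g'), (a *: h + h'); split.
- by move=> i; apply: (ur_D AU) => //; apply: (ur_M AU).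
- by apply: (inG_D CC AU) => //; apply: (inG_Z CC AU).
- by apply: (inG_D CC AU) => //; apply: (inG_Z CC AU).
rewrite D1_lin // D2_lin //.
under [X in _ = X + _ + _]eq_bigr do rewrite scalerDl -scalerA.
by rewrite big_split -scaler_sumr /= !scalerDr; ring.
Qed.

Lemma D1_0 : D1 0 = 0.
Proof. exact: (dop0 CC AU n_gt0 A_alpha alpha_le A_tau fst n vP_weight). Qed.

Lemma D2_0 : D2 0 = 0.
Proof. exact: (dop0 CC AU n_gt0 A_alpha alpha_le A_tau snd 1 vQ_weight). Qed.

Lemma reducible0 : reducible 0.
Proof.
exists (fun=> 0), 0, 0; split; try exact: (inG_0 CC AU).
  by move=> _; apply: (ur_0 AU).
by rewrite D1_0 D2_0 big1 ?addr0 // => i _; rewrite scale0r.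
Qed.

Lemma reducibleB j : valid j -> reducible (B j).
Proof.
case: j => [[i [|a]] b] vj.
  case: b vj => [|b] vj.
    exists (fun k => (k == i)%:R), 0, 0; split; try exact: (inG_0 CC AU).
      by move=> k; apply: (ur_nat AU).
    have li : (i < (2 * n).+1)%N by rewrite ltnS.
    rewrite -[B _]/(E i) D1_0 D2_0 !addr0 (bigD1 (Ordinal li)) //=.
    rewrite eqxx scale1r big1 => [|k ki]; first by rewrite addr0.
    by rewrite (_ : _ == i = false) ?scale0r //; apply: negbTE.
  exists (fun=> 0), 0, (B (i, 0%N, b)); split.
  - by move=> _; apply: (ur_0 AU).
  - exact: (inG_0 CC AU).
  - exact: B_G.
  - by rewrite D1_0 addr0 big1 ?add0r ?D2_B // => k _; rewrite scale0r.
exists (fun=> 0), (B (i, a, b)), 0; split.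
- by move=> _; apply: (ur_0 AU).
- exact: B_G.
- exact: (inG_0 CC AU).
- by rewrite D2_0 addr0 big1 ?add0r ?D1_B // => k _; rewrite scale0r.
Qed.

Lemma reducible_fin f : fin_span predT f -> reducible f.
Proof.
move=> [s [c [_ vs Ac ->]]]; elim: s vs => [|j s IH] vs.
  by rewrite big_nil; apply: reducible0.
rewrite big_cons; apply: reducible_lin => //.
  by apply: reducibleB; have := vs j (mem_head _ _); rewrite andbT.
by apply: IH => i si; apply: vs; rewrite in_cons si orbT.
Qed.

(* The reduction modulo [gt] is iterated; all three parts converge. *)
Lemma reduction f : inG 0 f -> reducible f.
Proof.
move=> hf.
(* [T] packs the coefficients, the two preimages and the remainder divided by [gt]; outside C0 its
   value is a default. *)
have /choice [T hT] : forall f, exists T : (nat -> C) * laurent * laurent * laurent,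
    inG 0 f -> inG 0 T.2 /\ reduces (f - gt *: T.2) T.1.1.1 T.1.1.2 T.1.2.
  move=> f0; have [hf0|nf] := pselect (inG 0 f0); last by exists (fun=> 0, 0, 0, 0).
  have [f1 /reducible_fin [c [g [h f1E]]]] := spanned 1 hf0.
  move=> /(inG_divX CC AU) [k hk kE]; exists (c, g, h, k) => _; split=> //=.
  by rewrite -[gt]expr1 -kE subKr.
pose fl := fix fl l := if l is l'.+1 then (T (fl l')).2 else f.
have hfl l : inG 0 (fl l) by elim: l => //= l IH; case: (hT _ IH).
pose c l := (T (fl l)).1.1.1; pose g l := (T (fl l)).1.1.2; pose h l := (T (fl l)).1.2.
have step l : reduces (fl l - gt *: fl l.+1) (c l) (g l) (h l).
  by case: (hT _ (hfl l)).
have Ac l i : A (c l i) by case: (step l).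
have hg l : inG 0 (g l) by case: (step l).
have hh l : inG 0 (h l) by case: (step l).
have AgX l : A (gt ^+ l) by apply/(ur_X AU)/(ur_gt AU).
have [g' [_ g'G]] := inG_series CC AU (fun l => inG_scale CC AU l (hg l)).
have [h' [_ h'G]] := inG_series CC AU (fun l => inG_scale CC AU l (hh l)).
have g'0 : inG 0 g' by have := g'G 0%N; rewrite big_ord0 subr0.
have h'0 : inG 0 h' by have := h'G 0%N; rewrite big_ord0 subr0.
have /choice [c' hc'] : forall i, exists l, forall N,
    abs (psum (fun l => gt ^+ l * c l i) N - l) <= 1 * r ^+ N.
  move=> i; apply: (series_geom CC r01 ler01) => l.
  by rewrite mul1r (absM CC) (absX CC) ler_piMr ?exprn_ge0 ?(ur_le1 AU) // ltW.
have Aps i N : A (psum (fun l => gt ^+ l * c l i) N).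
  by apply: (ur_sum AU) => l _; apply: (ur_M AU).
have Ac' i : A (c' i).
  apply: (ur_closed AU) => m; exists (psum (fun l => gt ^+ l * c l i) m) => //.
  by rewrite (abs_distC CC) (le_trans (hc' i m)) // mul1r.
exists c', g', h'; split=> //; apply/eqP; rewrite -subr_eq0; apply/eqP.
apply: (inG_sep CC AU) => N.
pose gN := \sum_(l < N) gt ^+ l *: g l; pose hN := \sum_(l < N) gt ^+ l *: h l.
have gN0 : inG 0 gN.
  by apply: (inG_sum CC AU) => l _; apply: (inG_Z CC AU) => //; apply: hg.
have hN0 : inG 0 hN.
  by apply: (inG_sum CC AU) => l _; apply: (inG_Z CC AU) => //; apply: hh.
(* The exact identity after [N] rounds; passing to the limits changes each part by an element of
   gt^N C0. *)
have fE : f = \sum_(i < (2 * n).+1) psum (fun l => gt ^+ l * c l i) N *: E i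
    + D1 gN + D2 hN + gt ^+ N *: fl N.
  rewrite /gN /hN; clear gN hN gN0 hN0; elim: N => [|N IH].
    rewrite !big_ord0 D1_0 D2_0 scale1r !addr0 big1 ?add0r //.
    by move=> i _; rewrite /psum big_ord0 scale0r.
  rewrite [in LHS]IH; have [_ _ _ sN] := step N.
  have -> : fl N = \sum_(i < (2 * n).+1) c N i *: E i + D1 (g N) + D2 (h N) + gt *: fl N.+1.
    by rewrite -sN subrK.
  rewrite [\sum_(l < N.+1) _ *: g _]big_ord_recr [\sum_(l < N.+1) _ *: h _]big_ord_recr /=.
  have G0 (F : nat -> laurent) : (forall l, inG 0 (F l)) ->
      inG 0 (\sum_(i < N) gt ^+ i *: F i).
    by move=> hF; apply: (inG_sum CC AU) => l _; apply: (inG_Z CC AU).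
  rewrite [\sum_(i < N) _ *: g _ + _]addrC [\sum_(i < N) _ *: h _ + _]addrC.
  rewrite D1_lin ?D2_lin //; [|exact: G0|exact: G0].
  move: (D1 (g N)) (D2 (h N)) (D1 (\sum_(i < N) _)) (D2 (\sum_(i < N) _)) => x y z w.
  under [X in _ = X + _ + _ + _]eq_bigr do rewrite psumS scalerDl -scalerA.
  rewrite big_split -scaler_sumr /= !scalerDr scalerA -exprSr; ring.
pose S := \sum_(i < (2 * n).+1) (psum (fun l => gt ^+ l * c l i) N - c' i) *: E i.
have -> : f - (\sum_(i < (2 * n).+1) c' i *: E i + D1 g' + D2 h') =
    S - D1 (g' - gN) - D2 (h' - hN) + gt ^+ N *: fl N.
  have D1B : D1 (g' - gN) = D1 g' - D1 gN.
    rewrite [g' - gN]addrC -scaleN1r D1_lin //; last exact/(ur_N AU)/(ur_1 AU).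
    by rewrite scaleN1r addrC.
  have D2B : D2 (h' - hN) = D2 h' - D2 hN.
    rewrite [h' - hN]addrC -scaleN1r D2_lin //; last exact/(ur_N AU)/(ur_1 AU).
    by rewrite scaleN1r addrC.
  rewrite D1B D2B /S; under [X in _ = X - _ - _ + _]eq_bigr do rewrite scalerBl.
  rewrite sumrB {1}fE; ring.
apply: (inG_D CC AU); last exact: (inG_scale CC AU).
apply: (inG_B CC AU); last exact/D2_G/h'G.
apply: (inG_B CC AU); last exact/D1_G/g'G.
apply: (inG_sum CC AU) => i _; set x := _ - _.
have Ax : A (x / gt ^+ N).
  apply: (ur_div AU); first exact: (ur_B AU (Aps i N) (Ac' i)).
  by rewrite -[leRHS]mul1r; apply: hc'.
rewrite -[x](divfK (expf_neq0 N gt0)) mulrC -scalerA.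
by apply: (inG_scale CC AU); apply: (inG_Z CC AU) => //; apply: E_G.
Qed.

Lemma fin_D1 f : fin_span predT f -> fin_span (fun j => 0 < j.1.2 + j.2)%N (D1 f).
Proof.
move=> [s [c [_ vs Ac ->]]].
rewrite (dop_sum CC AU n_gt0 A_alpha alpha_le A_tau fst n vP_weight) //; last exact: B_G.
apply: fin_sum => // -[[i a] b] /vs vj; rewrite D1_B; apply: finB => //=.
by case/andP: vj.
Qed.

Lemma fin_D2 f : fin_span predT f -> fin_span (fun j => 0 < j.1.2 + j.2)%N (D2 f).
Proof.
move=> [s [c [_ vs Ac ->]]].
rewrite (dop_sum CC AU n_gt0 A_alpha alpha_le A_tau snd 1 vQ_weight) //; last exact: B_G.
apply: fin_sum => // -[[i a] b] /vs vj; rewrite D2_B; apply: finB => //=.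
  by case/andP: vj.
by rewrite addnS.
Qed.

(** Replacing [g] and [h] by finite combinations modulo gt^m turns the relation into a finite one
    between distinct members of the family, modulo gt^m; so every power of [gt] divides each
    [c i]. *)
Lemma independence (c : nat -> C) g h : (forall i, A (c i)) ->
  inG 0 g -> inG 0 h ->
  \sum_(i < (2 * n).+1) c i *: E i = D1 g + D2 h ->
  forall i, (i < (2 * n).+1)%N -> c i = 0.
Proof.
move=> Ac hg hh e i hi; apply: (abs_eq0_geom CC (b := 1) r01) => m; rewrite mul1r.
have [g1 fg1 gg1] := spanned m hg; have [h1 fh1 hh1] := spanned m hh.
have g10 := fin_G fg1; have h10 := fin_G fh1.
have : fin_span (fun j => 0 < j.1.2 + j.2)%N (D1 g1 + D2 h1).
  rewrite -[D1 g1]scale1r; apply: fin_lin; first exact: (ur_1 AU).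
  - exact: fin_D1.
  - exact: fin_D2.
move=> [s [d [us vs Ad dE]]].
pose s0 : seq idx := [seq (k, 0%N, 0%N) | k <- iota 0 (2 * n).+1].
(* Members with a + b > 0 come from the images of the operators and change side, hence the sign. *)
pose c0 (j : idx) := if (0 < j.1.2 + j.2)%N then - d j else c j.1.1.
have mem_s0 j : j \in s0 -> valid j /\ (0 < j.1.2 + j.2)%N = false.
  by move=> /mapP[k]; rewrite mem_iota => hk ->; split=> //; rewrite /valid /=; lia.
have sE : \sum_(j <- s0 ++ s) c0 j *: B j =
    \sum_(k < (2 * n).+1) c k *: E k - (D1 g1 + D2 h1).
  rewrite big_cat dE /= big_map; congr (_ + _); last first.
    rewrite -sumrN; apply: eq_big_seq => j /vs /andP[_ Pj].
    by rewrite /c0 Pj scaleNr.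
  by rewrite -(big_mkord xpredT (fun k => c k *: E k)) /index_iota subn0.
have := @indep m (s0 ++ s) c0; rewrite sE => /(_ _ _ _ _ (i, 0%N, 0%N)); apply.
- rewrite cat_uniq us andbT map_inj_uniq ?iota_uniq /=; last by move=> ? ? [].
  by apply/hasPn => j /vs /andP[_ Pj]; apply/negP => /mem_s0 [_]; rewrite Pj.
- move=> j; rewrite mem_cat => /orP[/mem_s0[]//|/vs /andP[]//].
- by move=> j; rewrite /c0; case: ifP => // _; apply: (ur_N AU).
- rewrite e.
  have D1B : D1 (g - g1) = D1 g - D1 g1.
    rewrite [g - g1]addrC -scaleN1r D1_lin //; last exact/(ur_N AU)/(ur_1 AU).
    by rewrite scaleN1r addrC.
  have D2B : D2 (h - h1) = D2 h - D2 h1.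
    rewrite [h - h1]addrC -scaleN1r D2_lin //; last exact/(ur_N AU)/(ur_1 AU).
    by rewrite scaleN1r addrC.
  rewrite opprD addrACA -D1B -D2B.
  by apply: (inG_D CC AU); [apply: D1_G | apply: D2_G].
- rewrite mem_cat; apply/orP; left; apply/mapP; exists i => //.
  by rewrite mem_iota.
Qed.

End Basis.

(** * Direct sums and quotient bases *)

Section QuotientBasis.
Variables (K : nzRingType) (V : lmodType K) (S : set K) (I : finType).
Variables (M W : set V) (e : I -> V).
Hypothesis S_B : forall x y, S x -> S y -> S (x - y).
Hypothesis S_M : forall x y, S x -> S y -> S (x * y).
Hypothesis S_1 : S 1.
Hypotheses (subM : is_submod S M) (subW : is_submod S W) (WM : W `<=` M).
Hypothesis eM : forall i, M (e i).
Hypothesis e_span : forall m, M m -> exists c w,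
  [/\ forall i, S (c i), W w & m = \sum_i c i *: e i + w].
Hypothesis e_free : forall c, (forall i, S (c i)) -> W (\sum_i c i *: e i) ->
  forall i, c i = 0.

Let S_0 : S 0. Proof. by rewrite -(subrr 1); apply: S_B. Qed.
Let S_N x : S x -> S (- x).
Proof. by move=> Sx; rewrite -sub0r; apply: S_B. Qed.
Let S_D x y : S x -> S y -> S (x + y).
Proof. by move=> Sx Sy; rewrite -[y]opprK; apply: S_B => //; apply: S_N. Qed.

Lemma submod_lin (N : set V) c f g : is_submod S N -> S c -> N f -> N g -> N (c *: f + g).
Proof. by case=> _ h; apply: h. Qed.

Lemma submod_D (N : set V) f g : is_submod S N -> N f -> N g -> N (f + g).
Proof. by move=> sN Nf Ng; rewrite -[f]scale1r; apply: submod_lin. Qed.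

Lemma submod_B (N : set V) f g : is_submod S N -> N f -> N g -> N (f - g).
Proof.
by move=> sN Nf Ng; rewrite addrC -scaleN1r; apply: submod_lin => //; apply: S_N.
Qed.

Lemma submod_sum (N : set V) (F : I -> V) : is_submod S N -> (forall i, N (F i)) ->
  N (\sum_i F i).
Proof.
move=> sN NF; elim/big_ind: _ => //; first by case: sN.
by move=> x y; apply: submod_D.
Qed.

Lemma submod_line (v : V) : is_submod S (line S v).
Proof.
split; first by exists 0; rewrite ?scale0r.
move=> c _ _ Sc [x Sx <-] [y Sy <-]; exists (c * x + y).
  by apply: S_D => //; apply: S_M.
by rewrite scalerDl scalerA.
Qed.

Lemma line_sub (v : V) : M v -> line S v `<=` M.
Proof.
by move=> Mv _ [c Sc <-]; rewrite -[_ *: _]addr0; case: subM => M0 h; apply: h.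
Qed.

(** Subtracting the two expressions puts a combination of the [e i] into [W], where freeness
    applies. *)
Lemma coord_uniq (c d : I -> K) (w w' : V) : (forall i, S (c i)) -> (forall i, S (d i)) ->
  W w -> W w' -> \sum_i c i *: e i + w = \sum_i d i *: e i + w' ->
  c = d /\ w = w'.
Proof.
move=> Sc Sd Ww Ww' h; have cd : c = d.
  apply/funext => i; apply/eqP; rewrite -subr_eq0; apply/eqP.
  apply: (e_free (c := fun i => c i - d i)) => [j|]; first exact: S_B.
  under eq_bigr do rewrite scalerBl.
  rewrite sumrB (_ : _ - _ = w' - w); first exact: submod_B.
  by apply: (addIr w); rewrite subrK addrAC h addrC addKr.
by split=> //; move: h; rewrite cd => /addrI.
Qed.

Lemma sum_option (F : option I -> V) : \sum_k F k = \sum_i F (Some i) + F None.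
Proof.
rewrite (bigD1 None) //= addrC; congr (_ + _).
rewrite (reindex_omap Some id) => [|[i|]] //=.
by apply: eq_bigl => i; rewrite eqxx.
Qed.

Lemma direct_sum_basis : is_direct_sum S M
  (fun k : option I => if k is Some i then line S (e i) else W).
Proof.
split=> //.
- by case=> [i|] //; apply: submod_line.
- apply/seteqP; split=> [m Mm|_ [f hf <-]].
    have [c [w [Sc Ww ->]]] := e_span Mm.
    exists (fun k => if k is Some i then c i *: e i else w); last exact: sum_option.
    by case=> [i|] //; exists (c i).
  rewrite sum_option; apply: submod_D => //; last exact: WM (hf None).
  by apply: submod_sum => // i; apply: line_sub (eM i) _ (hf (Some i)).
move=> f g hf hg; rewrite !sum_option.
have /choice [c hc] : forall i, exists c, S c /\ c *: e i = f (Some i).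
  by move=> i; have [c ? ?] := hf (Some i); exists c.
have /choice [d hd] : forall i, exists d, S d /\ d *: e i = g (Some i).
  by move=> i; have [d ? ?] := hg (Some i); exists d.
under eq_bigr do rewrite -(proj2 (hc _)).
under [in X in _ = X]eq_bigr do rewrite -(proj2 (hd _)).
move=> /coord_uniq [i|i|||cd fg]; [by case: (hc i) | by case: (hd i) | exact: (hf None)
  | exact: (hg None) |].
apply/funext => -[i|//]; rewrite -(proj2 (hc i)) -(proj2 (hd i)); congr (_ *: _).
exact: (congr1 (@^~ i) cd).
Qed.

Lemma quotient_basis : is_quotient_basis S M W e.
Proof.
split=> // m Mm; have [c [w [Sc Ww mE]]] := e_span Mm; exists c; split.
  by split=> //; rewrite mE addrC addKr.
move=> d [Sd Wd]; apply: (proj1 (coord_uniq Sc Sd Ww Wd _)).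
by rewrite -mE addrC subrK.
Qed.

End QuotientBasis.

Theorem theorem2p7
  (R : realType) (C : closedFieldType) (abs : C -> R)
  (p n a : nat)
  (p_prime : prime p) (p_odd : odd p) (n_gt1 : (1 < n)%N)
  (p_ndvd_n : ~~ (p %| n)%N) (a_gt0 : (0 < a)%N)
  (C_Cp : is_Cp abs p)
  (Qq : set C) (Qq_unramified : is_Qq abs a Qq)
  (Fq : finFieldType) (card_Fq : #|Fq| = (p ^ a)%N)
  (red : C -> Fq) (red_residue : is_residue_map abs Qq red)
  (t : Fq) (t_neq0 : t != 0)
  (tb : C) (tb_teich : is_teichmuller abs Qq red t tb)
  (gam : C)
  (gam_root : cvg_abs abs (psum (fun k => gam ^+ (p ^ k) / p%:R ^+ k)) 0)
  (gam_ord : ordp abs p gam = 1 / (p - 1)%N%:R)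
  (gt : C) (gt_root : gt ^+ n = gam)
  (zeta : C) (zeta_prim : p.-primitive_root zeta)
  (sig : C -> C)
  (sig_aut : is_field_aut (gen_subfield (Qq `|` [set zeta; gt])) sig)
  (sig_frob : is_frobenius abs p Qq sig)
  (sig_zeta : sig zeta = zeta) (sig_gt : sig gt = gt) :
  let Zqg := adjoin (integers abs Qq) gt in
  let C0 := C0 abs n Zqg gt in
  let Dx := Dx abs p n gam tb sig in
  let Dy := Dy abs p gam tb sig in
  let W := sumset (Dx @` C0) (Dy @` C0) in
  let e (i : 'I_(2 * n).+1) := teps n gt i in
  [/\ forall eta, C0 eta ->
        exists (c : 'I_(2 * n).+1 -> C) (xix xiy : laurent2 C),
          [/\ forall i, Zqg (c i), C0 xix, C0 xiy &
              eta = \sum_i c i *: e i + Dx xix + Dy xiy],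
      is_direct_sum Zqg C0
        (fun k : option 'I_(2 * n).+1 =>
           if k is Some i then line Zqg (e i) else W) &
      is_quotient_basis Zqg C0 W e].
Proof.
move=> Zqg C0' Dx' Dy' W e.
have n_gt0 : (0 < n)%N := ltnW n_gt1.
have AU : is_unif_ring abs Zqg gt.
  exact: (adjoin_unif_ring p_prime C_Cp n_gt0 Qq_unramified red_residue
    gam_root gam_ord gt_root).
pose alpha i : C := gammai p gam i * p%:R ^+ i.
pose tau i : C := iter i sig tb.
have A_alpha i : Zqg (alpha i).
  exact: (A_gammai p_prime C_Cp Qq_unramified gt_root).
have alpha_le i : abs (alpha i) <= abs gt ^+ (n * p ^ i + i).
  exact: (abs_gammai p_prime C_Cp n_gt0 gam_root gam_ord gt_root).
have A_tau i : Zqg (tau i).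
  by case: tb_teich => Otb _ _; apply: (A_frobenius C_Cp gt Qq_unramified).
have abs_alpha0 : abs (alpha 0%N) = abs gt ^+ n by apply: (abs_gammai0 C_Cp gt_root).
have abs_tau0 : abs (tau 0%N) = 1 by apply: (abs_teich red_residue t_neq0 tb_teich).
have abs_n : abs n%:R = 1 by apply: (abs_coprime p_prime C_Cp).
pose D1 := dop abs p alpha tau fst (vP n) n.
pose D2 := dop abs p alpha tau snd vQ 1.
have DxE : Dx' = D1 by [].
(* Not a mere conversion as for [Dx]: the common form carries a factor [kap = 1] that [Dy] lacks. *)
have DyE : Dy' = D2.
  apply/funext => f; apply/funext => u; rewrite /Dy' /Dy /D2 /dop; congr (_ + infsum _ _).
  by apply/funext => i; rewrite /sop mul1r.
have C0E : C0' = inG abs Zqg gt n 0.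
  by apply/funext => f; apply/propext; apply: (C0P C_Cp AU n_gt0).
have pt0 i : pt n (i, 0%N, 0%N) = if (i <= n)%N then (i%:Z, 0) else ((i - n)%N%:Z, 1).
  rewrite /pt muln0 !addn0 subr0 oppr0 addr0.
  by case: eqP => [->|_] //; rewrite subr0.
(* The normalisations agree because n times the weight of eps_i is [i]. *)
have eE i : e i = weps gt n i.
  apply/funext => u; rewrite -[LHS]/(gt ^+ i * eps C n i u) /weps /wmonom nw_pt //.
  rewrite addn0 muln0 addn0 pt0 /eps; congr (_ * _).
  by case: ifP.
have red_f := reduction C_Cp AU n_gt0 A_alpha alpha_le A_tau abs_alpha0 abs_tau0 abs_n.
have indep_f := independence C_Cp AU n_gt0 A_alpha alpha_le A_tau abs_alpha0
  abs_tau0 abs_n.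
have subC0 : is_submod Zqg C0'.
  rewrite C0E; split; first exact: (inG_0 C_Cp AU).
  by move=> c f g Ac hf hg; apply: (inG_D C_Cp AU) => //; apply: (inG_Z C_Cp AU).
have D1_C0 f : C0' f -> C0' (D1 f).
  rewrite C0E; exact: (D1_G C_Cp AU n_gt0 A_alpha alpha_le A_tau).
have D2_C0 f : C0' f -> C0' (D2 f).
  rewrite C0E; exact: (D2_G C_Cp AU n_gt0 A_alpha alpha_le A_tau).
have WE w : W w <-> exists g h, [/\ C0' g, C0' h & w = D1 g + D2 h].
  rewrite /W DxE DyE; split.
    by move=> [_ [_ [[g Gg <-] [h Gh <-] ->]]]; exists g, h.
  by move=> [g [h [Gg Gh ->]]]; exists (D1 g), (D2 h).
have subW : is_submod Zqg W.
  have [G0 Glin] := subC0; split.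
    apply/WE; exists 0, 0; split=> //.
    rewrite /D1 (D1_0 C_Cp AU n_gt0 A_alpha alpha_le A_tau).
    by rewrite /D2 (D2_0 C_Cp AU n_gt0 A_alpha alpha_le A_tau) addr0.
  move=> c _ _ Ac /WE[g [h [Gg Gh ->]]] /WE[g' [h' [Gg' Gh' ->]]].
  apply/WE; exists (c *: g + g'), (c *: h + h'); split; [exact: Glin | exact: Glin |].
  move: Gg Gh Gg' Gh'; rewrite C0E => Gg Gh Gg' Gh'.
  rewrite /D1 (D1_lin C_Cp AU n_gt0 A_alpha alpha_le A_tau) //.
  rewrite /D2 (D2_lin C_Cp AU n_gt0 A_alpha alpha_le A_tau) //.
  by rewrite scalerDr addrACA.
have WC0 : W `<=` C0'.
  move=> _ /WE[g [h [Gg Gh ->]]]; rewrite -[D1 g]scale1r.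
  by apply: (proj2 subC0); [exact: (ur_1 AU) | exact: D1_C0 | exact: D2_C0].
have eC0 i : C0' (e i) by rewrite eE C0E; apply: (E_G C_Cp AU n).
have span eta : C0' eta -> exists (c : 'I_(2 * n).+1 -> C) xix xiy,
    [/\ forall i, Zqg (c i), C0' xix, C0' xiy &
      eta = \sum_i c i *: e i + D1 xix + D2 xiy].
  rewrite C0E => /red_f [c [g [h [Ac Gg Gh ->]]]].
  exists (fun i => c i), g, h; split=> //; congr (_ + _ + _).
  by apply: eq_bigr => i _; rewrite eE.
have e_span m : C0' m -> exists c w,
    [/\ forall i, Zqg (c i), W w & m = \sum_i c i *: e i + w].
  move=> /span [c [g [h [Ac Gg Gh ->]]]]; exists c, (D1 g + D2 h); split=> //.
    by apply/WE; exists g, h.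
  by rewrite -addrA.
have e_free c : (forall i, Zqg (c i)) -> W (\sum_i c i *: e i) -> forall i, c i = 0.
  move=> Ac /WE [g [h [Gg Gh ghE]]] i; move: Gg Gh; rewrite C0E => Gg Gh.
  (* [inord] extends the family from ordinals to all naturals, as [independence] expects. *)
  have := indep_f (fun k => c (inord k)) g h (fun k => Ac _) Gg Gh _ i (ltn_ord i).
  rewrite inord_val; apply; rewrite -[RHS]ghE; apply: eq_bigr => k _.
  by rewrite inord_val eE.
split.
- by rewrite DxE DyE.
- exact: (direct_sum_basis (ur_B AU) (ur_M AU) (ur_1 AU) subC0 subW WC0 eC0 e_span e_free).
- exact: (quotient_basis (ur_B AU) (ur_1 AU) subC0 subW WC0 eC0 e_span e_free).
Qed.
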